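(* Let $L>0$, $\lambda>0$, $l\ge2$ an integer, and let real coefficients $a_{l+j,l-j},b_{l+j,l-j}$ ($j=1,\dots,l-1$) satisfy the Coefficient Conditions. Then for every $f\in L^2(0,L)$ the boundary value problem $$\lambda u+\sum_{j=1}^{l}(-1)^{j+1}D^{2j+1}u=f\quad\text{in }(0,L),$$ together with the Boundary Conditions, admits a unique solution $u\in H^{2l+1}(0,L)$, and $$\|u\|_{H^{2l+1}(0,L)}\le C\|f\|_{L^2(0,L)}$$ with a constant $C$ depending only on $L$, $l$, $\lambda$ and the coefficients $a_{l+j,l-j}$, $b_{l+j,l-j}$.
   Context: $D^i=\frac{d^i}{dx^i}$; $H^m(0,L)$ is the Sobolev space with norm $\|u\|_{H^m}^2=\sum_{j=0}^m\|D^ju\|_{L^2}^2$ (functions in $H^{2l+1}(0,L)$ have continuous derivatives up to order $2l$ on $[0,L]$, so the boundary conditions make sense). Boundary Conditions: $u(0)=u(L)=D^lu(L)=0$; $D^{l+j}u(0)=a_{l+j,l-j}D^{l-j}u(0)$ and $D^{l+j}u(L)=b_{l+j,l-j}D^{l-j}u(L)$ for $j=1,\dots,l-1$. Coefficient Conditions: - If $l=2$: $b_{3,1}>\tfrac12$ and $a_{3,1}<\tfrac12$. - If $l=3$: $b_{5,1}<-\tfrac12$, $b_{4,2}>\tfrac12$, $a_{5,1}>\tfrac12$, $a_{4,2}<\tfrac12$. - If $l\ge4$: $b_{l+1,l-1}>l-2$, $b_{l+2,l-2}<2-l$, $a_{l+1,l-1}<5-2l$, $a_{l+2,l-2}>2l-5$;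 for odd $j$ with $3\le j\le l-1$: $b_{l+j,l-j}>l-2+\frac12\big(\sum_{m=1}^{(j-1)/2}|b_{l+2m-1,l-2m+1}|\big)^2$ and $a_{l+j,l-j}<5-2l-\frac12\big(\sum_{m=1}^{(j-1)/2}|a_{l+2m-1,l-2m+1}|\big)^2$; for even $j$ with $4\le j\le l-1$: $b_{l+j,l-j}<2-l-\frac12\big(\sum_{m=1}^{j/2-1}|b_{l+2m,l-2m}|\big)^2$ and $a_{l+j,l-j}>2l-5+\frac12\big(\sum_{m=1}^{j/2-1}|a_{l+2m,l-2m}|\big)^2$. *)

(* Defs.v *)
From HB Require Import structures.
From mathcomp Require Import all_boot all_order all_algebra.
From mathcomp Require Import all_classical all_reals all_analysis.
Set Implicit Arguments. Unset Strict Implicit. Unset Printing Implicit Defensive.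
Import Order.TTheory GRing.Theory Num.Theory.
Import numFieldNormedType.Exports.
Local Open Scope classical_set_scope.
Local Open Scope ring_scope.

Section Defs.
Context {R : realType}.
Notation mu := (@lebesgue_measure R).

Definition I0 (x : R) : set R := `[0, x].

Definition L2 (L : R) (f : R -> R) : Prop :=
  measurable_fun (I0 L) f /\
  (\int[mu]_(x in I0 L) ((f x) ^+ 2)%:E < +oo)%E.

Definition L2norm (L : R) (f : R -> R) : R :=
  Num.sqrt (fine (\int[mu]_(x in I0 L) ((f x) ^+ 2)%:E)).

(* u : nat -> R -> R is a function u 0 in H^m(0,L) together with its
   derivatives u k = D^k (u 0), k <= m, in the (1-d) absolutely continuous
   representation: u 0, ..., u (m-1) are continuous on [0,L], u m is in
   L^2(0,L), and each u k (k < m) is the primitive of u (k+1):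
   u k x = u k 0 + \int_0^x u (k+1). *)
Definition isH (L : R) (m : nat) (u : nat -> R -> R) : Prop :=
  [/\ (forall k, (k < m)%N -> {within I0 L, continuous (u k)}),
      L2 L (u m),
      (forall k, (k <= m)%N -> mu.-integrable (I0 L) (EFin \o u k)) &
      (forall k, (k < m)%N -> forall x, 0 <= x <= L ->
         (u k x)%:E = ((u k 0)%:E + \int[mu]_(t in I0 x) (u k.+1 t)%:E)%E)].

Definition Hnorm (L : R) (m : nat) (u : nat -> R -> R) : R :=
  Num.sqrt (\sum_(0 <= j < m.+1) (L2norm L (u j)) ^+ 2).

(* Boundary conditions; a j stands for a_{l+j,l-j}, b j for b_{l+j,l-j}. *)
Definition BC (L : R) (l : nat) (a b : nat -> R) (u : nat -> R -> R) : Prop :=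
  [/\ u 0%N 0 = 0, u 0%N L = 0, u l L = 0 &
      forall j, (1 <= j <= l.-1)%N ->
        u (l + j)%N 0 = a j * u (l - j)%N 0 /\
        u (l + j)%N L = b j * u (l - j)%N L].

Definition Eqn (L lam : R) (l : nat) (f : R -> R) (u : nat -> R -> R) : Prop :=
  {ae mu, forall x, 0 < x < L ->
     lam * u 0%N x + \sum_(1 <= j < l.+1) (-1) ^+ j.+1 * u (2 * j).+1%N x = f x}.

Definition solution (L lam : R) (l : nat) (a b : nat -> R) (f : R -> R)
  (u : nat -> R -> R) : Prop :=
  [/\ isH L (2 * l).+1 u, BC L l a b u & Eqn L lam l f u].

(* Coefficient Conditions (a j = a_{l+j,l-j}, b j = b_{l+j,l-j}). *)
Definition coef_cond (l : nat) (a b : nat -> R) : Prop :=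
  if l == 2%N then 1/2 < b 1%N /\ a 1%N < 1/2
  else if l == 3%N then
    [/\ b 2%N < -(1/2), 1/2 < b 1%N, 1/2 < a 2%N & a 1%N < 1/2]
  else
    [/\ l%:R - 2 < b 1%N /\ b 2%N < 2 - l%:R,
        a 1%N < 5 - 2 * l%:R /\ 2 * l%:R - 5 < a 2%N,
        (forall j, odd j -> (3 <= j <= l.-1)%N ->
           l%:R - 2 + 1/2 * (\sum_(1 <= m < (j.-1./2).+1) `|b (2 * m).-1|) ^+ 2 < b j /\
           a j < 5 - 2 * l%:R - 1/2 * (\sum_(1 <= m < (j.-1./2).+1) `|a (2 * m).-1|) ^+ 2) &
        (forall j, ~~ odd j -> (4 <= j <= l.-1)%N ->
           b j < 2 - l%:R - 1/2 * (\sum_(1 <= m < j./2) `|b (2 * m)%N|) ^+ 2 /\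
           2 * l%:R - 5 + 1/2 * (\sum_(1 <= m < j./2) `|a (2 * m)%N|) ^+ 2 < a j)].

End Defs.

(* Main.v *)
Require Import Defs.
From HB Require Import structures.
From mathcomp Require Import all_boot all_order all_algebra.
From mathcomp Require Import all_classical all_reals all_analysis.
From mathcomp Require Import measurable_realfun.
From mathcomp Require Import zify ring lra.
Set Implicit Arguments. Unset Strict Implicit. Unset Printing Implicit Defensive.
Import Order.TTheory GRing.Theory Num.Theory.
Import numFieldNormedType.Exports.
Local Open Scope classical_set_scope.
Local Open Scope ring_scope.

(* Uniqueness. For a solution [w] of the homogeneous problem, integrating
   [w * \sum_j (-1)^(j+1) D^(2j+1) w] by parts produces a quadratic form [E] in
   the derivatives of [w] with [E' = - lam * w^2]. The coefficient conditions make
   the form nonnegative at [L] and nonpositive at [0]: after the boundary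
   conditions are substituted, its diagonal entries dominate the cross terms,
   which only couple indices of the same parity. So [E] is constant and [w = 0].

   Existence. If [d] satisfies the linear recurrence attached to the equation and
   [J] is integration from [0], then [u_k = \sum_n d_(n+k) J^n g] satisfies
   [u_k = d_k g + J u_(k+1)]. The choice [g = 1] gives a basis of the homogeneous
   solutions, [g = J f] a particular solution. The boundary conditions become
   a square linear system, whose matrix is invertible by uniqueness, and all the
   bounds are linear in [\int |f|]. *)

(** * The boundary quadratic form *)

Section QuadraticForms.
Context {R : realFieldType}.
Implicit Types (c e h w y : nat -> R) (x K : R).

(** Young's inequality term by term; as the weights are nonnegative, their squares sum to at most
    the square of their sum. This is how squared sums of absolute values enter the coefficient
    conditions. *)
Lemma double_mul_wsum_le n c w x :
  (forall i, 0 <= c i) -> 0 <= x ->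
  2 * x * (\sum_(i < n) c i * w i) <=
  (\sum_(i < n) c i) ^+ 2 * x ^+ 2 + \sum_(i < n) w i ^+ 2.
Proof.
move=> c0 x0; elim: n => [|n IHn]; first by rewrite !big_ord0; nra.
rewrite !big_ord_recr /=.
have S0 : 0 <= \sum_(i < n) c i by apply: sumr_ge0.
have := mulr_ge0 (mulr_ge0 S0 (c0 n)) (sqr_ge0 x).
have := sqr_ge0 (c n * x - w n); nra.
Qed.

(** With unit weights the factor is [n], whereas the weighted version would give [n ^+ 2], more than
    [dominant_form_ge] can afford. *)
Lemma double_mul_sum_le n w x :
  2 * x * (\sum_(i < n) w i) <= n%:R * x ^+ 2 + \sum_(i < n) w i ^+ 2.
Proof.
elim: n => [|n IHn]; first by rewrite !big_ord0; nra.
rewrite !big_ord_recr /= -natr1; have := sqr_ge0 (x - w n); nra.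
Qed.

Lemma sqr_sum_le n w :
  (\sum_(i < n) w i) ^+ 2 <= n%:R * \sum_(i < n) w i ^+ 2.
Proof.
elim: n => [|n IHn]; first by rewrite !big_ord0; nra.
have := double_mul_sum_le n w (w n); rewrite !big_ord_recr /= -natr1; nra.
Qed.

(** Adding index [M] costs, by Young, half of [\sum_(k < M) h k ^+ 2] for each of the two cross
    sums, hence one unit of margin on the earlier squares. The new square keeps at least
    [K - M%:R / 2], since the excess of [e M] over [K] pays for the weighted part. *)
Lemma dominant_form_ge M K e h :
  (forall i, 0 <= h i) ->
  (forall i, (i < M)%N -> K + 1/2 * (\sum_(k < i) `|e k|) ^+ 2 <= e i) ->
  (K - M%:R + 1) * (\sum_(i < M) h i ^+ 2) <=
  \sum_(i < M) (e i * h i ^+ 2 - h i * \sum_(k < i) (1 + `|e k|) * h k).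
Proof.
move=> h0; elim: M => [|M IHM] He; first by rewrite !big_ord0 mulr0.
have {}IHM := IHM (fun i iM => He i (ltnW iM)).
rewrite !big_ord_recr /= -natr1.
have HM := He M (ltnSn M).
have H1 := @double_mul_wsum_le M (fun i => `|e i|) h (h M) (fun i => normr_ge0 _) (h0 M).
have H2 := double_mul_sum_le M h (h M).
have -> : \sum_(k < M) (1 + `|e k|) * h k =
    \sum_(k < M) h k + \sum_(k < M) `|e k| * h k.
  by rewrite -big_split; apply: eq_bigr => i _; rewrite mulrDl mul1r.
have H3 := ler_wpM2r (sqr_ge0 (h M)) HM.
have : 0 <= M%:R * h M ^+ 2 by rewrite mulr_ge0 ?sqr_ge0.
move: (\sum_(i < M) `|e i|) (\sum_(i < M) `|e i| * h i) (\sum_(i < M) h i)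
  (\sum_(i < M) h i ^+ 2) (\sum_(i < M) _) (M%:R : R) H1 H2 H3 IHM => a1 a2 a3 a4 a5 a6.
lra.
Qed.

(* The boundary term of the integration by parts: [(energy l u)' =
   u * \sum_(1 <= j <= l) (-1)^(j+1) D^(2j+1) u] for [y k = D^k u]. *)
Definition energy (l : nat) (y : nat -> R) : R :=
  \sum_(1 <= j < l.+1) (-1) ^+ j.+1 *
    (\sum_(k < j) (-1) ^+ k * y k * y (2 * j - k)%N + (-1) ^+ j * y j ^+ 2 / 2).

Lemma triangular_sum l (F : nat -> nat -> R) :
  \sum_(1 <= j < l.+1) \sum_(k < j) F j k =
  \sum_(k < l) \sum_(1 <= s < (l - k).+1) F (k + s)%N k.
Proof.
elim: l => [|l IHl]; first by rewrite big_geq // big_ord0.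
rewrite big_nat_recr //= IHl 2!big_ord_recr /= subSnn big_nat1 addn1 addrA.
congr (_ + _); rewrite -big_split /=; apply: eq_bigr => k _.
rewrite subSn ?(ltnW (ltn_ord k)) // [in RHS]big_nat_recr //=.
by congr (_ + F _ _); have := ltn_ord k; lia.
Qed.

(** Products are grouped by the distance [p] of their lower order from [l]. The summand [s = p]
    pairs the orders [l - p] and [l + p], which the boundary conditions link, so it will become a
    square. *)
Lemma energyE l y : y 0%N = 0 -> (0 < l)%N ->
  energy l y = - (1/2) * (\sum_(1 <= j < l.+1) y j ^+ 2) +
    \sum_(1 <= p < l)
      y (l - p)%N * \sum_(1 <= s < p.+1) (-1) ^+ s.+1 * y (l - p + 2 * s)%N.
Proof.
move=> y0 l0.
have sgn j : (-1) ^+ j.+1 * (-1) ^+ j = -1 :> R.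
  by rewrite exprS mulN1r mulNr -exprMn mulrNN mulr1 expr1n.
rewrite /energy; under eq_bigr do rewrite mulrDr mulr_sumr.
rewrite big_split /= addrC; congr (_ + _).
  by rewrite mulr_sumr; apply: eq_bigr => j _; rewrite !mulrA sgn; lra.
rewrite (triangular_sum l
  (fun j k => (-1) ^+ j.+1 * ((-1) ^+ k * y k * y (2 * j - k)%N))).
rewrite -(big_mkord xpredT (fun k => \sum_(1 <= s < (l - k).+1)
  (-1) ^+ (k + s).+1 * ((-1) ^+ k * y k * y (2 * (k + s) - k)%N))).
rewrite (@big_ltn _ _ _ 0) // big1_seq ?add0r; last first.
  by move=> s _; rewrite y0 !(mulr0, mul0r).
rewrite [RHS]big_nat_rev /=; apply: eq_big_nat => k /andP[k0 kl].
rewrite add1n subSS subKn ?(ltnW kl) // mulr_sumr; apply: eq_bigr => s _.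
rewrite (_ : (2 * (k + s) - k = k + 2 * s)%N); last by lia.
rewrite -addnS exprD.
have -> : (-1) ^+ k * (-1) ^+ s.+1 * ((-1) ^+ k * y k * y (k + 2 * s)%N)
  = ((-1) ^+ k * (-1) ^+ k) * (y k * ((-1) ^+ s.+1 * y (k + 2 * s)%N)) by ring.
by rewrite -exprMn mulrNN mulr1 expr1n mul1r.
Qed.

(** The orders strictly between [l - p] and [l + p] with the parity of [l - p]: the cofactors of
    [y (l - p)] that remain once the square is set aside. *)
Definition mid_sum l y p := \sum_(1 <= s < p) `|y (l - p + 2 * s)%N|.

Lemma mid_sum_step l y p : (0 < p)%N -> (p.+2 <= l)%N ->
  mid_sum l y p.+2 = mid_sum l y p + `|y (l - p)%N| + `|y (l + p)%N|.
Proof.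
move=> p0 pl; rewrite /mid_sum big_nat_recr //= big_ltn // big_add1 /=.
rewrite (_ : (l - p.+2 + 2 * 1 = l - p)%N); last by lia.
rewrite (_ : (l - p.+2 + 2 * p.+1 = l + p)%N); last by lia.
rewrite [\sum_(1 <= i < p) _](_ : _ = mid_sum l y p) /mid_sum; first by ring.
by apply: eq_bigr => s _; congr (`|y _|); lia.
Qed.

(** For odd [p] the orders pair off symmetrically about [l] and skip [l], so only orders below [l]
    remain. *)
Lemma mid_sum_odd l y e i : (2 * i + 1 < l)%N ->
  (forall p, (0 < p < l)%N -> `|y (l + p)%N| = `|e p| * `|y (l - p)%N|) ->
  mid_sum l y (2 * i + 1) =
  \sum_(k < i) (1 + `|e (2 * k + 1)%N|) * `|y (l - (2 * k + 1))%N|.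
Proof.
move=> + He; elim: i => [|i IHi] il; first by rewrite big_ord0 /mid_sum big_geq.
rewrite big_ord_recr /= -IHi; last by lia.
rewrite (_ : (2 * i.+1 + 1 = (2 * i + 1).+2)%N); last by lia.
by rewrite mid_sum_step ?He; [ring|lia..].
Qed.

(** For even [p] the middle order [l] is left unpaired; the boundary conditions make it vanish at
    [L], but not at [0]. *)
Lemma mid_sum_even l y e i : (2 * i + 2 < l)%N ->
  (forall p, (0 < p < l)%N -> `|y (l + p)%N| = `|e p| * `|y (l - p)%N|) ->
  mid_sum l y (2 * i + 2) = `|y l| +
  \sum_(k < i) (1 + `|e (2 * k + 2)%N|) * `|y (l - (2 * k + 2))%N|.
Proof.
move=> + He; elim: i => [|i IHi] il.
  rewrite big_ord0 /mid_sum big_nat1 addr0; congr (`|y _|); lia.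
rewrite big_ord_recr /= addrA -IHi; last by lia.
rewrite (_ : (2 * i.+1 + 2 = (2 * i + 2).+2)%N); last by lia.
by rewrite mid_sum_step ?He; [ring|lia..].
Qed.

Lemma sum_parity l (F : nat -> R) : \sum_(1 <= p < l) F p =
  \sum_(i < l./2) F (2 * i + 1)%N + \sum_(i < l.-1./2) F (2 * i + 2)%N.
Proof.
elim: l => [|[|l] IHl]; first by rewrite big_geq // !big_ord0 addr0.
  by rewrite big_geq // !big_ord0 addr0.
rewrite big_nat_recr //= {}IHl /= uphalfE /=.
rewrite -(odd_double_half l); case: (odd l); rewrite /= ?add1n ?add0n /=.
  rewrite doubleK uphalf_double [X in _ = _ + X]big_ord_recr /=.
  by rewrite -addrA mul2n addn2.
by rewrite doubleK uphalf_double [X in _ = X + _]big_ord_recr /= addrAC mul2n addn1.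
Qed.

Lemma sum_sqr_split l y : (0 < l)%N -> \sum_(1 <= j < l.+1) y j ^+ 2 =
  y l ^+ 2 + \sum_(i < l./2) `|y (l - (2 * i + 1))%N| ^+ 2 +
  \sum_(i < l.-1./2) `|y (l - (2 * i + 2))%N| ^+ 2.
Proof.
move=> l0; rewrite big_nat_recr //= addrC -addrA; congr (_ + _).
rewrite big_nat_rev /= -(sum_parity l (fun p => `|y (l - p)%N| ^+ 2)).
by apply: eq_big_nat => p _; rewrite add1n subSS real_normK ?num_real.
Qed.

(** The sign [t] selects the endpoint: [1] for [L], [-1] for [0], where the opposite inequality is
    wanted. Odd and even [p] decouple, so [dominant_form_ge] applies to each class; only even [p]
    interact with [y l]. *)
Lemma boundary_form_ge l y c (t Ko Ke : R) : `|t| = 1 ->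
  (forall p, (0 < p < l)%N -> y (l + p)%N = c p * y (l - p)%N) ->
  (forall i, (i < l./2)%N ->
    Ko + 1/2 * (\sum_(k < i) `|c (2 * k + 1)%N|) ^+ 2 <= t * c (2 * i + 1)%N) ->
  (forall i, (i < l.-1./2)%N ->
    Ke + 1/2 * (\sum_(k < i) `|c (2 * k + 2)%N|) ^+ 2 <= - t * c (2 * i + 2)%N) ->
  (Ko - (l./2)%:R + 1) * (\sum_(i < l./2) `|y (l - (2 * i + 1))%N| ^+ 2) +
  (Ke - (l.-1./2)%:R + 1) * (\sum_(i < l.-1./2) `|y (l - (2 * i + 2))%N| ^+ 2) -
  `|y l| * (\sum_(i < l.-1./2) `|y (l - (2 * i + 2))%N|) <=
  t * \sum_(1 <= p < l)
      y (l - p)%N * \sum_(1 <= s < p.+1) (-1) ^+ s.+1 * y (l - p + 2 * s)%N.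
Proof.
move=> t1 yc Ho He.
(* The coefficient of [y (l - p) ^+ 2] after the condition at order [l + p] is substituted. *)
pose e p := t * (-1) ^+ p.+1 * c p.
pose h p := `|y (l - p)%N|.
have normE p : `|e p| = `|c p|.
  by rewrite /e !normrM t1 normrX normrN1 expr1n !mul1r.
have yce p : (0 < p < l)%N -> `|y (l + p)%N| = `|e p| * `|y (l - p)%N|.
  by move=> pl; rewrite normE yc // normrM.
have eo i : e (2 * i + 1)%N = t * c (2 * i + 1)%N.
  by rewrite /e addn1 -signr_odd /= oddM /= expr0 mulr1.
have ee i : e (2 * i + 2)%N = - t * c (2 * i + 2)%N.
  by rewrite /e addn2 -signr_odd /= oddM /= expr1 mulrN1.
have term p : (1 <= p < l)%N -> e p * h p ^+ 2 - h p * mid_sum l y p <=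
  t * (y (l - p)%N * \sum_(1 <= s < p.+1) (-1) ^+ s.+1 * y (l - p + 2 * s)%N).
  move=> /andP[p0 pl]; rewrite big_nat_recr //= (_ : (l - p + 2 * p = l + p)%N); last by lia.
  rewrite yc ?p0 // /h real_normK ?num_real // !mulrDr addrC lerD //; last first.
    by rewrite /e le_eqVlt; apply/orP; left; apply/eqP; ring.
  rewrite lerNl; apply: le_trans (ler_norm _) _.
  rewrite normrN !normrM t1 mul1r ler_wpM2l //.
  apply: le_trans (ler_norm_sum _ _ _) _; apply: ler_sum => s _.
  by rewrite normrM normrX normrN1 expr1n mul1r.
rewrite mulr_sumr; apply: le_trans; last by apply: ler_sum_nat => p; exact: term.
rewrite sum_parity.
have Fo := @dominant_form_ge l./2 Ko (fun i => e (2 * i + 1)%N) (fun i => h (2 * i + 1)%N)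
  (fun i => normr_ge0 _).
have Fe := @dominant_form_ge l.-1./2 Ke (fun i => e (2 * i + 2)%N) (fun i => h (2 * i + 2)%N)
  (fun i => normr_ge0 _).
have Go i : (i < l./2)%N -> (2 * i + 1 < l)%N by move: (odd_double_half l); lia.
have Ge i : (i < l.-1./2)%N -> (2 * i + 2 < l)%N by move: (odd_double_half l.-1); lia.
rewrite -addrA; apply: lerD.
  apply: le_trans (Fo _) _.
    by move=> i il; under eq_bigr do rewrite normE; rewrite eo; exact: Ho.
  by apply: ler_sum => i _; rewrite (mid_sum_odd _ yce) // Go.
rewrite [X in _ - X]mulr_sumr -sumrN; apply: le_trans; first apply: lerD (lexx _).
  apply: (Fe _); move=> i il; under eq_bigr do rewrite normE; rewrite ee; exact: He.
rewrite -big_split /=; apply: ler_sum => i _.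
rewrite (mid_sum_even _ yce) ?Ge // mulrDr opprD addrCA addrC lerD2r lerN2 mulrC //.
Qed.

(** Here [y l = 0] removes the coupling between even orders and [l], but the term [-1/2] on every
    square must be absorbed, so both margins have to reach [1/2]. *)
Lemma energy_ge0 l y c (Ko Ke : R) : (0 < l)%N -> y 0%N = 0 -> y l = 0 ->
  (forall p, (0 < p < l)%N -> y (l + p)%N = c p * y (l - p)%N) ->
  (forall i, (i < l./2)%N ->
    Ko + 1/2 * (\sum_(k < i) `|c (2 * k + 1)%N|) ^+ 2 <= c (2 * i + 1)%N) ->
  (forall i, (i < l.-1./2)%N ->
    Ke + 1/2 * (\sum_(k < i) `|c (2 * k + 2)%N|) ^+ 2 <= - c (2 * i + 2)%N) ->
  (l./2)%:R <= Ko + 1/2 -> (l.-1./2)%:R <= Ke + 1/2 -> 0 <= energy l y.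
Proof.
move=> l0 y0 yl yc Ho He Ko_ge Ke_ge; rewrite energyE // sum_sqr_split //.
have Ho' i : (i < l./2)%N ->
    Ko + 1/2 * (\sum_(k < i) `|c (2 * k + 1)%N|) ^+ 2 <= 1 * c (2 * i + 1)%N.
  by rewrite [1 * c _]mul1r; exact: Ho.
have He' i : (i < l.-1./2)%N ->
    Ke + 1/2 * (\sum_(k < i) `|c (2 * k + 2)%N|) ^+ 2 <= -1 * c (2 * i + 2)%N.
  by rewrite mulN1r; exact: He.
have := boundary_form_ge (normr1 _) yc Ho' He'; rewrite yl normr0.
set So := \sum_(i < l./2) _; set Se := \sum_(i < l.-1./2) _ ^+ 2.
have So0 : 0 <= So by apply: sumr_ge0 => i _; exact: sqr_ge0.
have Se0 : 0 <= Se by apply: sumr_ge0 => i _; exact: sqr_ge0.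
nra.
Qed.

(** The squares with factor [-1/2] now help. Those below order [l] relax the margins; that of [y l]
    absorbs the coupling through Young and [sqr_sum_le], at the price of [(l.-1./2)%:R / 2] on the
    even squares, whence the factor [3/2]. *)
Lemma energy_le0 l y c (Ko Ke : R) : (0 < l)%N -> y 0%N = 0 ->
  (forall p, (0 < p < l)%N -> y (l + p)%N = c p * y (l - p)%N) ->
  (forall i, (i < l./2)%N ->
    Ko + 1/2 * (\sum_(k < i) `|c (2 * k + 1)%N|) ^+ 2 <= - c (2 * i + 1)%N) ->
  (forall i, (i < l.-1./2)%N ->
    Ke + 1/2 * (\sum_(k < i) `|c (2 * k + 2)%N|) ^+ 2 <= c (2 * i + 2)%N) ->
  (l./2)%:R <= Ko + 3/2 -> 3/2 * (l.-1./2)%:R <= Ke + 3/2 -> energy l y <= 0.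
Proof.
move=> l0 y0 yc Ho He Ko_ge Ke_ge; rewrite energyE // sum_sqr_split //.
have Ho' i : (i < l./2)%N ->
    Ko + 1/2 * (\sum_(k < i) `|c (2 * k + 1)%N|) ^+ 2 <= -1 * c (2 * i + 1)%N.
  by rewrite mulN1r; exact: Ho.
have He' i : (i < l.-1./2)%N ->
    Ke + 1/2 * (\sum_(k < i) `|c (2 * k + 2)%N|) ^+ 2 <= - -1 * c (2 * i + 2)%N.
  by rewrite opprK [1 * c _]mul1r; exact: He.
have := boundary_form_ge (normrN1 _) yc Ho' He'.
set So := \sum_(i < l./2) _; set Se := \sum_(i < l.-1./2) _ ^+ 2.
set W := \sum_(i < l.-1./2) `|_|.
have So0 : 0 <= So by apply: sumr_ge0 => i _; exact: sqr_ge0.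
have Se0 : 0 <= Se by apply: sumr_ge0 => i _; exact: sqr_ge0.
have WS : W ^+ 2 <= (l.-1./2)%:R * Se := sqr_sum_le _ (fun i => `|y (l - (2 * i + 2))%N|).
have <- : `|y l| ^+ 2 = y l ^+ 2 by rewrite real_normK ?num_real.
have := sqr_ge0 (`|y l| - W); nra.
Qed.
End QuadraticForms.

(** * Signs of the boundary form under the coefficient conditions *)

Section CoefficientConditions.
Context {R : realType}.
Implicit Types (a b y : nat -> R).

Let oddsumE (c : nat -> R) i :
  \sum_(1 <= m < ((2 * i + 1).-1./2).+1) `|c (2 * m).-1| =
  \sum_(k < i) `|c (2 * k + 1)%N|.
Proof.
rewrite addn1 /= mul2n doubleK big_add1 /= big_mkord.
by apply: eq_bigr => k _; congr (`|c _|); lia.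
Qed.

Let evensumE (c : nat -> R) i :
  \sum_(1 <= m < (2 * i + 2)./2) `|c (2 * m)%N| =
  \sum_(k < i) `|c (2 * k + 2)%N|.
Proof.
rewrite addn2 /= mul2n doubleK big_add1 /= big_mkord.
by apply: eq_bigr => k _; congr (`|c _|); lia.
Qed.

Let half_le (n : nat) : 2 * (n./2)%:R <= n%:R :> R.
Proof.
by rewrite -natrM ler_nat mul2n -[leqRHS]odd_double_half leq_addl.
Qed.

Lemma coef_cond_energy_ge0 l a b y : (2 <= l)%N -> coef_cond l a b ->
  y 0%N = 0 -> y l = 0 ->
  (forall p, (0 < p < l)%N -> y (l + p)%N = b p * y (l - p)%N) ->
  0 <= energy l y.
Proof.
move=> l2 ab y0 yl yb; move: ab; rewrite /coef_cond.
case: eqP => [l_eq|l_neq2].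
  rewrite l_eq in yl yb *; move=> [b1 _].
  (* For [l = 2] and [l = 3] each parity class has at most one member, so the cross sums are empty
     and the threshold [1/2] suffices. *)
  apply: (@energy_ge0 _ _ _ b (1/2) (1/2)) => //=; try by lra.
  by case=> // _; rewrite big_ord0 ?muln0; lra.
case: eqP => [l_eq|l_neq3].
  rewrite l_eq in yl yb *; move=> [b2 b1 _ _].
  apply: (@energy_ge0 _ _ _ b (1/2) (1/2)) => //=; try by lra.
  - by case=> // _; rewrite big_ord0 ?muln0; lra.
  - by case=> // _; rewrite big_ord0 ?muln0; lra.
move=> [[b1 b2] _ bodd beven].
have l4 : (4 <= l)%N by lia.
have l4r : 4 <= l%:R :> R by rewrite (ler_nat _ 4).
have lp : l.-1%:R = l%:R - 1 :> R by rewrite -subn1 natrB // (leq_trans _ l2).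
have hl := half_le l; have hl1 := half_le l.-1.
(* The number of orders of either parity is at most [l / 2], which is below [l - 2 + 1/2] because
   [4 <= l]. *)
apply: (@energy_ge0 _ _ _ b (l%:R - 2) (l%:R - 2)) => //; try by lra.
- by rewrite (leq_trans _ l2).
(* The case [i = 0] is the separately stated condition on [b 1], where the sum is empty. *)
- case=> [_|i il]; first by rewrite big_ord0 expr0n /= mulr0 addr0 ltW.
  have oi : odd (2 * i.+1 + 1) by rewrite oddD oddM.
  have [|+ _] := bodd _ oi; first by move: (odd_double_half l); lia.
  by rewrite oddsumE => /ltW.
- case=> [_|i il].
    by rewrite big_ord0 expr0n /= mulr0 addr0 muln0 add0n; lra.
  have oi : ~~ odd (2 * i.+1 + 2) by rewrite oddD oddM.
  have [|+ _] := beven _ oi; first by move: (odd_double_half l.-1); lia.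
  by rewrite evensumE; lra.
Qed.

Lemma coef_cond_energy_le0 l a b y : (2 <= l)%N -> coef_cond l a b ->
  y 0%N = 0 ->
  (forall p, (0 < p < l)%N -> y (l + p)%N = a p * y (l - p)%N) ->
  energy l y <= 0.
Proof.
move=> l2 ab y0 ya; move: ab; rewrite /coef_cond.
case: eqP => [l_eq|l_neq2].
  rewrite l_eq in ya *; move=> [_ a1].
  (* The odd threshold may be negative at [0]: [-1/2 + 3/2] is exactly the number of odd orders. *)
  apply: (@energy_le0 _ _ _ a (-(1/2)) (1/2)) => //=; try by lra.
  by case=> // _; rewrite big_ord0 ?muln0; lra.
case: eqP => [l_eq|l_neq3].
  rewrite l_eq in ya *; move=> [_ _ a2 a1].
  apply: (@energy_le0 _ _ _ a (-(1/2)) (1/2)) => //=; try by lra.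
  - by case=> // _; rewrite big_ord0 ?muln0; lra.
  - by case=> // _; rewrite big_ord0 ?muln0; lra.
move=> [_ [a1 a2] aodd aeven].
have l4 : (4 <= l)%N by lia.
have l4r : 4 <= l%:R :> R by rewrite (ler_nat _ 4).
have lp : l.-1%:R = l%:R - 1 :> R by rewrite -subn1 natrB // (leq_trans _ l2).
have hl := half_le l; have hl1 := half_le l.-1.
apply: (@energy_le0 _ _ _ a (2 * l%:R - 5) (2 * l%:R - 5)) => //; try by lra.
- by rewrite (leq_trans _ l2).
- case=> [_|i il].
    by rewrite big_ord0 expr0n /= mulr0 addr0 muln0 add0n; lra.
  have oi : odd (2 * i.+1 + 1) by rewrite oddD oddM.
  have [|_ +] := aodd _ oi; first by move: (odd_double_half l); lia.
  by rewrite oddsumE; lra.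
- case=> [_|i il].
    by rewrite big_ord0 expr0n /= mulr0 addr0 muln0 add0n; lra.
  have oi : ~~ odd (2 * i.+1 + 2) by rewrite oddD oddM.
  have [|_ +] := aeven _ oi; first by move: (odd_double_half l.-1); lia.
  by rewrite evensumE; lra.
Qed.
End CoefficientConditions.

(** * Primitives on [[0, L]] *)

Section Primitives.
Context {R : realType}.
Notation mu := (@lebesgue_measure R).
Implicit Types (g h : R -> R) (x L : R).

Lemma measurable_I0 x : measurable (I0 x).
Proof. exact: measurable_itv. Qed.

Lemma I0_subset x L : x <= L -> I0 x `<=` I0 L.
Proof.
by move=> xL t; rewrite /I0 /= !in_itv /= => /andP[-> tx]; exact: le_trans xL.
Qed.

Lemma mu_I0 x : 0 <= x -> mu (I0 x) = x%:E.
Proof.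
move=> x0; rewrite lebesgue_measure_itv /= lte_fin lt_neqAle x0 andbT.
by case: eqP => [<- //|_] /=; rewrite oppr0 addr0.
Qed.

Lemma within_continuousD (A : set R) g h : {within A, continuous g} ->
  {within A, continuous h} -> {within A, continuous (fun t => g t + h t)}.
Proof. by move=> cg ch t; apply: cvgD; [exact: cg|exact: ch]. Qed.

Lemma within_continuousM (A : set R) g h : {within A, continuous g} ->
  {within A, continuous h} -> {within A, continuous (fun t => g t * h t)}.
Proof. by move=> cg ch t; apply: cvgM; [exact: cg|exact: ch]. Qed.

Lemma within_continuous_cst (A : set R) (c : R) :
  {within A, continuous (fun=> c)}.
Proof. by move=> t; exact: cvg_cst. Qed.

Lemma within_continuous_sum (I : eqType) (A : set R) (s : seq I) (F : I -> R -> R) :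
  (forall i, i \in s -> {within A, continuous (F i)}) ->
  {within A, continuous (fun t => \sum_(i <- s) F i t)}.
Proof.
elim: s => [|i s IHs] cF.
  by under eq_fun do rewrite big_nil; exact: within_continuous_cst.
under eq_fun do rewrite big_cons.
apply: within_continuousD; first by apply: cF; rewrite mem_head.
by apply: IHs => j js; apply: cF; rewrite inE js orbT.
Qed.

Lemma within_continuous_eq (A : set R) g h : {in A, g =1 h} ->
  {within A, continuous g} -> {within A, continuous h}.
Proof. by move=> gh; apply: subspace_eq_continuous => t At; exact: gh. Qed.

Lemma continuous_integrable_I0 L g : {within I0 L, continuous g} ->
  mu.-integrable (I0 L) (EFin \o g).
Proof. by move=> cg; apply: continuous_compact_integrable => //; exact: segment_compact. Qed.

Lemma integrable_I0S x L g : x <= L ->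
  mu.-integrable (I0 L) (EFin \o g) -> mu.-integrable (I0 x) (EFin \o g).
Proof.
by move=> xL; apply: integrableS; [exact: measurable_I0..|exact: I0_subset].
Qed.

Definition primitive g x : R := \int[mu]_(t in I0 x) g t.

(** A real-valued integral sends infinite values to a default, so integrability is what links
    [primitive] to the extended-real integral in [isH]. *)
Lemma EFin_primitive L g x : x <= L -> mu.-integrable (I0 L) (EFin \o g) ->
  (primitive g x)%:E = (\int[mu]_(t in I0 x) (g t)%:E)%E.
Proof.
move=> xL /(integrable_I0S xL) ig; rewrite fineK //.
by apply: integrable_fin_num => //; exact: measurable_I0.
Qed.

Lemma primitive0 g : primitive g 0 = 0.
Proof. by rewrite /primitive /I0 set_itv1 Rintegral_set1. Qed.

Lemma eq_primitive g h x : (forall t, 0 <= t <= x -> g t = h t) ->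
  primitive g x = primitive h x.
Proof.
by move=> gh; apply: eq_Rintegral => t; rewrite inE /I0 /= in_itv /=; exact: gh.
Qed.

Lemma primitive_continuous L g : 0 <= L -> mu.-integrable (I0 L) (EFin \o g) ->
  {within I0 L, continuous (primitive g)}.
Proof. exact: parameterized_integral_continuous. Qed.

Lemma within_I0_continuous_at L g x : {within I0 L, continuous g} ->
  0 < x < L -> {for x, continuous g}.
Proof.
move=> cg xL; have /continuous_subspaceW : `]0, L[ `<=` I0 L.
  by move=> t; rewrite /I0 /= !in_itv /= => /andP[/ltW -> /ltW ->].
by move=> /(_ _ _ cg); rewrite continuous_open_subspace// => /(_ x); apply; rewrite inE /= in_itv.
Qed.

Lemma is_derive_primitive L g x : {within I0 L, continuous g} -> 0 < x < L ->
  is_derive x 1 (primitive g) (g x).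
Proof.
move=> cg xL; have cgx := within_I0_continuous_at cg xL; case/andP: xL => x0 xL.
have [dF F'] := continuous_FTC1_closed xL (continuous_integrable_I0 cg) x0 cgx.
apply: DeriveDef; first exact: dF.
by rewrite -derive1E; exact: F'.
Qed.

Lemma primitiveD L g h x : x <= L -> mu.-integrable (I0 L) (EFin \o g) ->
  mu.-integrable (I0 L) (EFin \o h) ->
  primitive (fun t => g t + h t) x = primitive g x + primitive h x.
Proof.
move=> xL ig ih.
by apply: RintegralD; [exact: measurable_I0|exact: integrable_I0S xL _..].
Qed.

Lemma primitiveZ L (c : R) g x : x <= L -> mu.-integrable (I0 L) (EFin \o g) ->
  primitive (fun t => c * g t) x = c * primitive g x.
Proof.
by move=> xL ig; apply: RintegralZl; [exact: measurable_I0|exact: integrable_I0S xL _].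
Qed.

Lemma integrable_I0D L g h : mu.-integrable (I0 L) (EFin \o g) ->
  mu.-integrable (I0 L) (EFin \o h) ->
  mu.-integrable (I0 L) (EFin \o (fun t => g t + h t)).
Proof.
move=> ig ih; rewrite (_ : EFin \o _ = (EFin \o g) \+ (EFin \o h))%E; last exact/funext.
by apply: integrableD => //; exact: measurable_I0.
Qed.

Lemma integrable_I0Z L (c : R) g : mu.-integrable (I0 L) (EFin \o g) ->
  mu.-integrable (I0 L) (EFin \o (fun t => c * g t)).
Proof.
move=> ig; rewrite (_ : EFin \o _ = (fun t => c%:E * (EFin \o g) t))%E; last exact/funext.
by apply: integrableZl => //; exact: measurable_I0.
Qed.

Lemma is_derive_sum_nat m n (F : nat -> R -> R) (dF : nat -> R) x :
  (forall i, (m <= i < n)%N -> is_derive x 1 (F i) (dF i)) ->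
  is_derive x 1 (fun t => \sum_(m <= i < n) F i t) (\sum_(m <= i < n) dF i).
Proof.
elim: n => [|n IHn] dFi.
  by under eq_fun do rewrite big_geq //; rewrite big_geq //; exact: is_derive_cst.
case: (leqP m n) => mn; last first.
  by under eq_fun do rewrite big_geq //; rewrite big_geq //; exact: is_derive_cst.
under eq_fun do rewrite big_nat_recr //; rewrite big_nat_recr //=.
apply: is_deriveD; last by apply: dFi; rewrite mn ltnSn.
by apply: IHn => i /andP[mi ni]; apply: dFi; rewrite mi ltnW.
Qed.

Lemma is_derive_mul (f g : R -> R) x (df dg : R) : is_derive x 1 f df ->
  is_derive x 1 g dg -> is_derive x 1 (fun t => f t * g t) (df * g x + f x * dg).
Proof.
move=> Df Dg; apply: (is_derive_eq (is_deriveM Df Dg)).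
by rewrite /GRing.scale /= addrC mulrC.
Qed.

Lemma is_derive_scale (f : R -> R) x (c df : R) : is_derive x 1 f df ->
  is_derive x 1 (fun t => c * f t) (c * df).
Proof. by move=> Df; exact: is_deriveZ. Qed.

Lemma is_derive_energy l (w : nat -> R -> R) x :
  (forall k, (k <= 2 * l)%N -> is_derive x 1 (w k) (w k.+1 x)) ->
  is_derive x 1 (fun t => energy l (w^~ t))
    (w 0%N x * \sum_(1 <= j < l.+1) (-1) ^+ j.+1 * w (2 * j).+1 x).
Proof.
move=> dw; rewrite /energy mulr_sumr.
apply: is_derive_sum_nat => j /andP[j0 jl].
rewrite mulrCA; apply: is_derive_scale.
(* Repeated integration by parts, written as a telescoping sum; the final product is half the
   derivative of [w j ^+ 2]. *)
have -> : w 0%N x * w (2 * j).+1 x =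
  \sum_(0 <= k < j) (-1) ^+ k * (w k.+1 x * w (2 * j - k)%N x
     + w k x * w (2 * j - k).+1 x) + (-1) ^+ j * (w j x * w j.+1 x).
  rewrite (@telescope_sumr_eq _ 0 j
    (fun k => - ((-1) ^+ k * (w k x * w (2 * j - k).+1 x)))) // ?subn0 ?expr0.
  - rewrite (_ : (2 * j - j = j)%N); last by lia.
    by rewrite mulrCA; ring.
  - move=> k /andP[_ kj]; rewrite exprS (_ : (2 * j - k = (2 * j - k.+1).+1)%N); last by lia.
    by ring.
apply: is_deriveD.
  under eq_fun do rewrite -(big_mkord xpredT (fun k => (-1) ^+ k * w k _ * w (2 * j - k)%N _)).
  apply: is_derive_sum_nat => k /andP[_ kj].
  have d1 : is_derive x 1 (w k) (w k.+1 x) by apply: dw; lia.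
  have d2 : is_derive x 1 (w (2 * j - k)%N) (w (2 * j - k).+1 x) by apply: dw; lia.
  under eq_fun do rewrite -mulrA.
  by apply: is_derive_scale; exact: is_derive_mul.
have d1 : is_derive x 1 (w j) (w j.+1 x) by apply: dw; lia.
under eq_fun do rewrite -mulrA; apply: is_derive_scale.
under eq_fun do rewrite mulrC; under eq_fun do rewrite expr2.
rewrite [X in is_derive _ _ _ X](_ : _ = 2^-1 * (w j.+1 x * w j x + w j x * w j.+1 x)).
  by apply: is_derive_scale; exact: is_derive_mul.
by field.
Qed.
End Primitives.

(** * Uniqueness *)

Section Uniqueness.
Context {R : realType}.
Notation mu := (@lebesgue_measure R).

Lemma L2P (L : R) (f : R -> R) : L2 L f <->
  measurable_fun (I0 L) f /\ mu.-integrable (I0 L) (EFin \o (fun x => f x ^+ 2)).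
Proof.
split=> [[mf foo]|[mf /integrableP[_ foo]]]; split => //.
  apply/integrableP; split; first exact/measurable_EFinP/measurable_funX.
  by under eq_integral do rewrite /= ger0_norm ?sqr_ge0 //.
apply: le_lt_trans foo; rewrite le_eqVlt; apply/orP; left; apply/eqP.
by apply: eq_integral => x _; rewrite /= ger0_norm ?sqr_ge0.
Qed.

Lemma L2D (L c : R) (f g : R -> R) : L2 L f -> L2 L g ->
  L2 L (fun x => f x + c * g x).
Proof.
move=> /L2P[mf f2] /L2P[mg g2]; apply/L2P.
have mfg : measurable_fun (I0 L) (fun x => f x + c * g x).
  by apply: measurable_funD => //; apply: measurable_funM.
split=> //.
have i2 := integrable_I0D (integrable_I0Z 2 f2) (integrable_I0Z (2 * c ^+ 2) g2).
apply: le_integrable i2; first exact: measurable_I0.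
  exact/measurable_EFinP/measurable_funX.
move=> x _ /=; rewrite lee_fin ger0_norm ?sqr_ge0 // ger0_norm.
  by have := sqr_ge0 (f x - c * g x); nra.
by do ?[exact: sqr_ge0|apply: addr_ge0|apply: mulr_ge0].
Qed.

Lemma isH_primitive L m (u : nat -> R -> R) k x : isH L m u -> (k < m)%N ->
  0 <= x <= L -> u k x = u k 0 + primitive (u k.+1) x.
Proof.
move=> [_ _ iu uE] km xL; apply: EFin_inj.
rewrite uE // EFinD; congr (_ + _)%E; rewrite -(@EFin_primitive _ L) //.
  by case/andP: xL.
exact: iu.
Qed.

(** Below the top order integrability follows from continuity, so it is only asked of [u m]. *)
Lemma isH_intro L m (u : nat -> R -> R) :
  (forall k, (k < m)%N -> {within I0 L, continuous (u k)}) -> L2 L (u m) ->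
  mu.-integrable (I0 L) (EFin \o u m) ->
  (forall k, (k < m)%N -> forall x, 0 <= x <= L ->
     u k x = u k 0 + primitive (u k.+1) x) ->
  isH L m u.
Proof.
move=> cu L2u iu uE.
have iuk k : (k <= m)%N -> mu.-integrable (I0 L) (EFin \o u k).
  rewrite leq_eqVlt => /predU1P[-> //|km].
  exact/continuous_integrable_I0/cu.
split=> // k km x xL; rewrite uE // EFinD; congr (_ + _)%E.
by rewrite (@EFin_primitive _ L) //; [case/andP: xL|exact: iuk].
Qed.

Lemma isHD L m c (u v : nat -> R -> R) : isH L m u -> isH L m v ->
  isH L m (fun k x => u k x + c * v k x).
Proof.
move=> Hu Hv; have [cu L2u iu _] := Hu; have [cv L2v iv _] := Hv.
apply: isH_intro.
- move=> k km; apply: within_continuousD; first exact: cu.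
  by apply: within_continuousM; [exact: within_continuous_cst|exact: cv].
- exact: L2D.
- by apply: integrable_I0D; [exact: iu|apply/integrable_I0Z/iv].
- move=> k km x xL; rewrite (isH_primitive Hu) // (isH_primitive Hv) //.
  have xL' : x <= L by case/andP: xL.
  rewrite (@primitiveD _ L) ?(@primitiveZ _ L) //; [|exact: iv|exact: iu|exact/integrable_I0Z/iv].
  by ring.
Qed.

Lemma ae_neq (c : R) : {ae mu, forall x, x <> c}.
Proof.
exists [set c]; split=> [||x /=]; first exact: measurable_set1.
  exact: lebesgue_measure_set1.
exact: contrapT.
Qed.

Lemma is_derive_locally0 (L x df : R) (f : R -> R) :
  (forall t, 0 < t < L -> f t = 0) -> 0 < x < L -> is_derive x 1 f df -> df = 0.
Proof.
move=> f0 xL Df.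
have H : is_derive x 1 (cst 0) df.
  apply: near_eq_is_derive Df.
  have : x \in `]0, L[ by rewrite in_itv.
  by move=> /near_in_itvoo; apply: filterS => t; rewrite in_itv; exact: f0.
by have := @derive_val _ _ _ _ _ _ _ H; rewrite derive_cst.
Qed.

Lemma within_continuous_at0 (L : R) (f : R -> R) : 0 < L ->
  {within I0 L, continuous f} -> (forall t, 0 < t < L -> f t = 0) -> f 0 = 0.
Proof.
move=> L0 /(continuous_within_itvP _ L0)[_ f0 _] fz.
apply: (@cvg_unique _ _ (f @ 0^'+)) => //.
apply: cvg_near_cst; near=> t; apply: fz; apply/andP; split; near: t.
  exact: nbhs_right_gt.
exact: nbhs_right_lt.
Unshelve. all: by end_near. Qed.

(** The values [w k 0] are recorded as well, because [bc_matrix_unit] reads off from them the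
    coefficients of a combination of basis solutions. *)
Lemma homogeneous_solution_eq0 (L lam : R) l a b w : 0 < L -> 0 < lam ->
  (2 <= l)%N -> coef_cond l a b -> solution L lam l a b (fun=> 0) w ->
  (forall x, 0 <= x <= L -> w 0%N x = 0) /\
  (forall k, (k <= 2 * l)%N -> w k 0 = 0).
Proof.
move=> L0 lam0 l2 ab [Hw [w00 w0L wlL bc] eqn].
have [cw _ iw _] := Hw.
(* The equation solved for the top derivative, which is itself only in L^2 and satisfies the
   equation almost everywhere. With [g] in its place, the family [W] is continuous at every order
   and satisfies the equation everywhere. *)
pose g t := (-1) ^+ l * (lam * w 0%N t + \sum_(1 <= j < l) (-1) ^+ j.+1 * w (2 * j).+1 t).
pose W k := if (k <= 2 * l)%N then w k else g.
have W_w k t : (k <= 2 * l)%N -> W k t = w k t by rewrite /W => ->.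
have cg : {within I0 L, continuous g}.
  apply: within_continuousM; first exact: within_continuous_cst.
  apply: within_continuousD.
    by apply: within_continuousM; [exact: within_continuous_cst|exact: cw].
  apply: within_continuous_sum => j; rewrite mem_index_iota => /andP[j1 jl].
  by apply: within_continuousM; [exact: within_continuous_cst|apply: cw; lia].
have cW k : {within I0 L, continuous (W k)}.
  by rewrite /W; case: leqP => kl; [apply: cw|].
have eqW t : lam * W 0%N t + \sum_(1 <= j < l.+1) (-1) ^+ j.+1 * W (2 * j).+1 t = 0.
  rewrite big_nat_recr ?(leq_trans _ l2) //= {3}/W ltnn /g.
  rewrite exprS [_ * _ * (_ * _)](_ : _ = - ((-1) ^+ l * (-1) ^+ l) *
    (lam * w 0%N t + \sum_(1 <= j < l) (-1) ^+ j.+1 * w (2 * j).+1 t)); last by ring.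
  rewrite -exprMn mulrNN mulr1 expr1n mulN1r W_w // (eq_big_nat _ _
    (F2 := fun j => (-1) ^+ j.+1 * w (2 * j).+1 t)); first by ring.
  by move=> j /andP[j1 jl]; rewrite W_w //; lia.
have WP k x : (k <= 2 * l)%N -> 0 <= x <= L -> W k x = W k 0 + primitive (W k.+1) x.
  move=> kl xL; rewrite !W_w // (isH_primitive Hw) //; congr (_ + _).
  rewrite /W; case: leqP => // kl'.
  have -> : k = (2 * l)%N by lia.
  have xL' : x <= L by case/andP: xL.
  (* The top derivative and [g] agree almost everywhere, hence have the same primitive. The equation
     is given on the open interval, so both endpoints are discarded as null sets. *)
  congr fine; apply: ae_eq_integral.
  - exact: measurable_I0.
  - by have /integrableP[] := integrable_I0S xL' (iw _ (leqnn _)).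
  - by have /integrableP[] := integrable_I0S xL' (continuous_integrable_I0 cg).
  - near=> t; rewrite /I0 /= in_itv /= => /andP[t0 tx].
    have tL : 0 < t < L.
      rewrite !lt_neqAle t0 (le_trans tx xL') !andbT; apply/andP; split.
        by rewrite eq_sym; apply/eqP; near: t; exact: ae_neq.
      by apply/eqP; near: t; exact: ae_neq.
    have : lam * w 0%N t + \sum_(1 <= j < l.+1) (-1) ^+ j.+1 * w (2 * j).+1 t = 0.
      by move: tL; near: t; exact: eqn.
    rewrite big_nat_recr ?(leq_trans _ l2) //= /g => /eqP.
    rewrite addrA addr_eq0 => /eqP ->; congr EFin.
    rewrite exprS [RHS](_ : _ = ((-1) ^+ l * (-1) ^+ l) * w (2 * l).+1 t); last by ring.
    by rewrite -exprMn mulrNN mulr1 expr1n mul1r.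
have dW k x : (k <= 2 * l)%N -> 0 < x < L -> is_derive x 1 (W k) (W k.+1 x).
  move=> kl xL.
  have D : is_derive x 1 (fun t => W k 0 + primitive (W k.+1) t) (W k.+1 x).
    have := is_deriveD (is_derive_cst (W k 0) x 1) (is_derive_primitive (cW k.+1) xL).
    by rewrite add0r.
  apply: near_eq_is_derive D.
  have : x \in `]0, L[ by rewrite in_itv.
  move=> /near_in_itvoo; apply: filterS => t; rewrite in_itv /= => /andP[t0 tL].
  by rewrite [RHS]WP // !ltW.
pose E t := energy l (W^~ t).
have dE x : 0 < x < L -> is_derive x 1 E (- lam * W 0%N x ^+ 2).
  move=> xL; have := @is_derive_energy _ l W x (fun k kl => dW k x kl xL).
  move=> /is_derive_eq; apply; have /eqP := eqW x.
  by rewrite addrC addr_eq0 => /eqP ->; ring.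
have cE : {within I0 L, continuous E}.
  rewrite /E /energy; apply: within_continuous_sum => j _.
  apply: within_continuousM; first exact: within_continuous_cst.
  apply: within_continuousD.
    under eq_fun do rewrite -(big_mkord xpredT (fun k => (-1) ^+ k * W k _ * W (2 * j - k)%N _)).
    apply: within_continuous_sum => k _; do 2![apply: within_continuousM => //].
    exact: within_continuous_cst.
  apply: within_continuousM; last exact: within_continuous_cst.
  apply: within_continuousM; first exact: within_continuous_cst.
  by under eq_fun do rewrite expr2; exact: within_continuousM.
have E_le x y : 0 <= x -> x <= y -> y <= L -> E y <= E x.
  apply: ler0_derive1_nincr cE x y => x; rewrite in_itv /= => xL; have D := dE x xL.
    exact: ex_derive.
  by rewrite derive1E derive_val mulNr oppr_le0 mulr_ge0 ?sqr_ge0 // ltW.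
have E0 : E 0 <= 0.
  apply: (coef_cond_energy_le0 l2 ab) => [|p pl]; first by rewrite W_w.
  rewrite !W_w; [|lia..]; have [|-> //] := bc p; lia.
have EL : 0 <= E L.
  apply: (coef_cond_energy_ge0 l2 ab) => [||p pl]; first by rewrite W_w.
    by rewrite W_w //; lia.
  rewrite !W_w; [|lia..]; have [|_ -> //] := bc p; lia.
(* [E] is nonincreasing from a value at most 0 to a value at least 0. *)
have Ez t : 0 < t < L -> E t = 0.
  move=> /andP[t0 tL]; apply/eqP; rewrite eq_le.
  rewrite (le_trans (E_le 0 t _ _ _) E0) ?(le_trans EL (E_le t L _ _ _)) //; exact: ltW.
(* The derivative of [E = 0] gives [W 0 = 0]; each further [W k] is the derivative of a function
   already known to vanish. *)
have Wz k t : (k <= 2 * l)%N -> 0 < t < L -> W k t = 0.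
  elim: k t => [|k IHk] t kl tL.
    have /eqP := is_derive_locally0 Ez tL (dE t tL).
    by rewrite mulf_eq0 oppr_eq0 gt_eqF //= sqrf_eq0 => /eqP.
  exact: is_derive_locally0 (fun t => IHk t (ltnW kl)) tL (dW k t (ltnW kl) tL).
split=> [x|k kl]; last first.
  by rewrite -W_w //; apply: within_continuous_at0 L0 (cW k) _ => t; exact: Wz.
rewrite !le_eqVlt => /andP[/predU1P[<- //|x0] /predU1P[-> //|xL]].
by rewrite -W_w // Wz // x0.
Unshelve. all: by end_near. Qed.

Lemma solution_unique (L lam : R) l a b f u v : 0 < L -> 0 < lam ->
  (2 <= l)%N -> coef_cond l a b -> solution L lam l a b f u ->
  solution L lam l a b f v -> forall x, 0 <= x <= L -> u 0%N x = v 0%N x.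
Proof.
move=> L0 lam0 l2 ab [Hu [u1 u2 u3 ubc] ueq] [Hv [v1 v2 v3 vbc] veq] x xL.
pose w k x := u k x + (-1) * v k x.
have [|+ _] := @homogeneous_solution_eq0 L lam l a b w L0 lam0 l2 ab.
  split; first exact: isHD.
    split; rewrite /w ?u1 ?u2 ?u3 ?v1 ?v2 ?v3 ?mulr0 ?addr0 // => j jl.
    have [-> ->] := ubc j jl; have [-> ->] := vbc j jl.
    by split; ring.
  have FF : Filter (nbhs (almost_everywhere (@lebesgue_measure R))).
    exact: ae_filter_ringOfSetsType.
  near=> t => tL; rewrite /w.
  have : lam * v 0%N t + \sum_(1 <= j < l.+1) (-1) ^+ j.+1 * v (2 * j).+1 t = f t.
    by move: tL; near: t; exact: veq.
  have : lam * u 0%N t + \sum_(1 <= j < l.+1) (-1) ^+ j.+1 * u (2 * j).+1 t = f t.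
    by move: tL; near: t; exact: ueq.
  move=> Hu' Hv'; rewrite -[RHS](subrr (f t)) -[X in _ = X - _]Hu' -Hv'.
  rewrite opprD addrACA -sumrN -big_split /=.
  congr (_ + _); first by ring.
  by apply: eq_bigr => j _; ring.
by move=> /(_ x xL)/eqP; rewrite /w mulN1r subr_eq0 => /eqP.
Unshelve. all: by end_near. Qed.
End Uniqueness.

(** * Volterra series *)

Section LinearRecurrence.
Context {R : realFieldType}.
Variables (n : nat) (q v0 : nat -> R).

(** The companion map, acting on a window of [n] consecutive terms. *)
Definition rec_step (v : nat -> R) : nat -> R :=
  fun i => if (i.+1 < n)%N then v i.+1 else \sum_(k < n) q k * v k.

Definition rec_seq m := iter m rec_step v0 0%N.

Lemma rec_seq_state m i : (i < n)%N -> iter m rec_step v0 i = rec_seq (m + i).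
Proof.
elim: i m => [|i IHi] m ni; first by rewrite addn0.
by rewrite -addSnnS -IHi 1?ltnW // iterS {2}/rec_step ni.
Qed.

Lemma rec_seq_init i : (i < n)%N -> rec_seq i = v0 i.
Proof. by move=> ni; rewrite -[i]add0n -rec_seq_state. Qed.

Lemma rec_seqE m : (0 < n)%N -> rec_seq (m + n) = \sum_(k < n) q k * rec_seq (m + k).
Proof.
move=> n0; rewrite -{1}(prednK n0) -addSnnS -rec_seq_state ?prednK //.
rewrite iterS {1}/rec_step prednK // ltnn; apply: eq_bigr => k _.
by rewrite rec_seq_state.
Qed.

(** One companion step multiplies the maximum norm of the window by at most
    [1 + \sum_(k < n) |q k|]. *)
Lemma rec_seq_bound : exists D M : R, [/\ 0 <= D, 1 <= M &
  forall m, `|rec_seq m| <= D * M ^+ m].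
Proof.
(* The index [n] is included so that entry 0 is covered even when [n = 0]. *)
pose D := \sum_(k < n.+1) `|v0 k|; pose M := 1 + \sum_(k < n) `|q k|.
have D0 : 0 <= D by apply: sumr_ge0.
have M1 : 1 <= M by rewrite lerDl sumr_ge0.
have v0D i : (i <= n)%N -> `|v0 i| <= D.
  by move=> ni; rewrite /D (bigD1 (Ordinal (ni : (i < n.+1)%N))) //= lerDl sumr_ge0.
have st m i : (i <= n)%N -> `|iter m rec_step v0 i| <= D * M ^+ m.
  elim: m i => [|m IHm] i ni; first by rewrite expr0 mulr1 v0D.
  have DM0 : 0 <= D * M ^+ m by rewrite mulr_ge0 ?exprn_ge0 // (le_trans ler01).
  rewrite iterS {1}/rec_step; case: ifP => ni'.
    apply: le_trans (IHm _ (ltnW ni')) _.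
    by rewrite exprS mulrCA ler_peMl.
  apply: le_trans (ler_norm_sum _ _ _) _.
  rewrite exprS mulrCA mulrDl mul1r.
  apply: le_trans (_ : _ <= (\sum_(k < n) `|q k|) * (D * M ^+ m)) _.
    rewrite mulr_suml; apply: ler_sum => k _; rewrite normrM ler_wpM2l //.
    by apply: IHm; exact: ltnW.
  by rewrite lerDr.
by exists D, M; split => // m; exact: st.
Qed.
End LinearRecurrence.

(** * Series of iterated primitives *)

Section VolterraSeries.
Context {R : realType}.
Notation mu := (@lebesgue_measure R).
Implicit Types (x t : R).

Lemma primitive_expR (c x : R) : 0 < c -> 0 <= x ->
  primitive (fun t => expR (c * t)) x = (expR (c * x) - 1) / c.
Proof.
move=> c0; rewrite le_eqVlt => /predU1P[<-|x0].
  by rewrite primitive0 mulr0 expR0 subrr mul0r.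
have dF t : is_derive t 1 (fun t => c^-1 * expR (c * t)) (expR (c * t)).
  have D : is_derive t 1 (fun t => expR (c * t)) (expR (c * t) * c).
    apply: (is_derive1_comp (is_derive_expR _)).
    by have := is_derive_scale c (is_derive_id t 1); rewrite mulr1.
  by have := is_derive_scale c^-1 D; rewrite mulrC mulfK // gt_eqF.
have cF : continuous (fun t => c^-1 * expR (c * t)).
  move=> t; apply/differentiable_continuous/derivable1_diffP.
  by have := dF t => D; exact: ex_derive.
have ce : continuous (fun t => expR (c * t)).
  move=> t; apply: continuous_comp; last exact: continuous_expR.
  by apply: cvgM; [exact: cvg_cst|exact: cvg_id].
rewrite /primitive /Rintegral (@continuous_FTC2 _ _ (fun t => c^-1 * expR (c * t))) //.
- by rewrite /= mulr0 expR0; field; rewrite gt_eqF.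
- exact: continuous_subspaceT.
- split.
  + by move=> t _; have := dF t => D; exact: ex_derive.
  + exact/cvg_at_right_filter/cF.
  + exact/cvg_at_left_filter/cF.
- by move=> t _; have := dF t => D; rewrite derive1E derive_val.
Qed.

Variables (L G D M : R) (g : R -> R) (d : nat -> R).
Hypotheses (L0 : 0 < L) (D0 : 0 <= D) (M1 : 1 <= M)
  (cg : {within I0 L, continuous g}) (gG : forall x, 0 <= x <= L -> `|g x| <= G)
  (dD : forall m, `|d m| <= D * M ^+ m).

Let phi n := iter n (@primitive R) g.

Let M0 : 0 < M. Proof. exact: lt_le_trans M1. Qed.

Let cphi n : {within I0 L, continuous (phi n)}.
Proof.
elim: n => [//|n IHn]; apply: primitive_continuous; first exact: ltW.
exact: continuous_integrable_I0.
Qed.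

(** Against the weight [expR (2 * M * x)] each integration gains a factor [1 / (2 * M)]. The rate
    [2 * M] beats the growth [M ^+ n] of [d] and leaves the geometric ratio [1/2] of [term_le]. *)
Let phi_le n x : 0 <= x <= L -> `|phi n x| <= G * expR (2 * M * x) / (2 * M) ^+ n.
Proof.
have G0 : 0 <= G by apply: le_trans (normr_ge0 (g 0)) (gG _); rewrite lexx ltW.
have MM0 : 0 < 2 * M by rewrite mulr_gt0.
elim: n x => [|n IHn] x /andP[x0 xL].
  rewrite expr0 divr1; apply: le_trans (gG _) _; first by rewrite x0.
  by rewrite ler_peMr // -[leLHS]expR0 ler_expR mulr_ge0 // ltW.
have iphi := integrable_I0S xL (continuous_integrable_I0 (@cphi n)).
have -> : phi n.+1 x = \int[mu]_(t in I0 x) phi n t by [].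
apply: le_trans (le_normr_Rintegral _ iphi) _; first exact: measurable_I0.
have ie : mu.-integrable (I0 x) (EFin \o (fun t => expR (2 * M * t))).
  apply: continuous_integrable_I0; apply: continuous_subspaceT => t.
  apply: continuous_comp; last exact: continuous_expR.
  by apply: cvgM; [exact: cvg_cst|exact: cvg_id].
apply: le_trans (_ : _ <= primitive (fun t => G / (2 * M) ^+ n * expR (2 * M * t)) x) _.
  apply: le_Rintegral; [exact: measurable_I0| |exact: integrable_I0Z|].
    exact: integrable_norm.
  move=> t; rewrite /I0 /= in_itv /= => /andP[t0 tx].
  by rewrite mulrAC; apply: IHn; rewrite t0 (le_trans tx).
rewrite (@primitiveZ _ x) // primitive_expR //.
have -> : G / (2 * M) ^+ n * ((expR (2 * M * x) - 1) / (2 * M)) =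
  G * (expR (2 * M * x) - 1) / (2 * M) ^+ n.+1.
  by rewrite exprSr [((2 * M) ^+ n * (2 * M))^-1]invfM; ring.
by rewrite ler_wpM2r ?invr_ge0 ?exprn_ge0 ?(ltW MM0) // ler_wpM2l // lerBlDr lerDl.
Qed.

Let term_le k n x : 0 <= x <= L ->
  `|d (n + k)%N * phi n x| <= geometric (D * M ^+ k * expR (2 * M * L) * G) 2^-1 n.
Proof.
move=> xL; rewrite normrM.
apply: le_trans (ler_pM _ _ (dD _) (phi_le n xL)) _ => //.
have G0 : 0 <= G := le_trans (normr_ge0 _) (gG xL).
have -> : D * M ^+ (n + k) * (G * expR (2 * M * x) / (2 * M) ^+ n) =
  D * M ^+ k * G * expR (2 * M * x) / 2 ^+ n.
  rewrite exprD exprMn invfM [LHS](_ : _ =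
    D * M ^+ k * G * expR (2 * M * x) / 2 ^+ n * (M ^+ n / M ^+ n)); last by ring.
  by rewrite divff ?mulr1 // expf_neq0 // gt_eqF.
rewrite /geometric /= exprVn ler_wpM2r ?invr_ge0 ?exprn_ge0 //.
rewrite -!mulrA [G * _]mulrC; do 2![rewrite ler_wpM2l ?exprn_ge0 ?(ltW M0) //].
rewrite ler_wpM2r // ler_expR !mulrA ler_wpM2l //; last by case/andP: xL.
by rewrite mulr_ge0 // ltW.
Qed.

Let half_lt1 : `|2^-1 : R| < 1.
Proof. by rewrite ger0_norm ?invr_ge0 // invf_lt1 // ltr1n. Qed.

Let partial k n x := series (fun i => d (i + k)%N * phi i x) n.

Definition volterra k x : R :=
  limn (series (fun i => d (i + k)%N * iter i (@primitive R) g x)).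

Let partial_le k n x : 0 <= x <= L ->
  `|partial k n x| <= 2 * (D * M ^+ k * expR (2 * M * L) * G).
Proof.
move=> xL; apply: le_trans (ler_norm_sum _ _ _) _.
apply: (@le_trans _ _ (series (geometric (D * M ^+ k * expR (2 * M * L) * G) 2^-1) n)).
  by apply: ler_sum_nat => i _; exact: term_le.
rewrite geometric_seriesE; last by rewrite lt_eqF // (le_lt_trans (ler_norm _)).
rewrite /=.
have G0 : 0 <= G := le_trans (normr_ge0 _) (gG xL).
set B := D * _ * _ * G.
have B0 : 0 <= B by rewrite !mulr_ge0 ?exprn_ge0 ?expR_ge0 // ltW.
have -> : B * (1 - 2^-1 ^+ n) / (1 - 2^-1) = 2 * B * (1 - 2^-1 ^+ n) by field.
have pn : 0 <= 2^-1 ^+ n :> R by rewrite exprn_ge0 // invr_ge0.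
by have := mulr_ge0 B0 pn; lra.
Qed.

Let partial_cvg k x : 0 <= x <= L -> partial k n x @[n --> \oo] --> volterra k x.
Proof.
move=> xL; apply: normed_cvg.
apply: (@series_le_cvg _ _ (geometric (D * M ^+ k * expR (2 * M * L) * G) 2^-1)) => //.
- by move=> n; exact: normr_ge0.
- by move=> n; exact: le_trans (normr_ge0 _) (term_le k n xL).
- by move=> n; exact: term_le.
- exact: is_cvg_geometric_series.
Qed.

Let cpartial k n : {within I0 L, continuous (partial k n)}.
Proof.
apply: within_continuous_sum => i _.
by apply: within_continuousM; [exact: within_continuous_cst|exact: cphi].
Qed.

Lemma volterra_le k x : 0 <= x <= L ->
  `|volterra k x| <= 2 * (D * M ^+ k * expR (2 * M * L) * G).
Proof.
move=> xL; apply: (cvgr_to_le (cvg_norm (@partial_cvg k x xL))).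
by apply: nearW => n; exact: partial_le.
Qed.

(** The series is a bounded pointwise limit of continuous functions. Integrability comes before
    continuity, which is deduced from it through [volterraE]. *)
Lemma volterra_integrable k : mu.-integrable (I0 L) (EFin \o volterra k).
Proof.
have ic : mu.-integrable (I0 L) (EFin \o (fun=> 2 * (D * M ^+ k * expR (2 * M * L) * G))).
  by apply: continuous_integrable_I0; exact: within_continuous_cst.
apply: le_integrable ic; first exact: measurable_I0.
  apply/measurable_EFinP.
  apply: (measurable_fun_cvg (h := fun n x => partial k n x)).
    move=> n; apply: subspace_continuous_measurable_fun; first exact: measurable_I0.
    exact: cpartial.
  by move=> x; rewrite /I0 /= in_itv; exact: partial_cvg.
move=> x; rewrite /I0 /= in_itv /= => xL; rewrite lee_fin.
by apply: le_trans (volterra_le k xL) (ler_norm _).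
Qed.

(** Integration raises the power of [J] by one, so the series of index [k.+1] becomes that of index
    [k] without its first term. *)
Let primitive_partial k n x : 0 <= x <= L ->
  primitive (partial k.+1 n) x = partial k n.+1 x - d k * g x.
Proof.
move=> /andP[x0 xL]; rewrite /partial /series /= big_nat_recl //= add0n.
rewrite addrC addKr; elim: n => [|n IHn].
  rewrite big_geq // (@eq_primitive _ _ (fun=> 0)); last by move=> t _; rewrite big_geq.
  by rewrite /primitive Rintegral_cst ?mul0r //; exact: measurable_I0.
have ip i : mu.-integrable (I0 L) (EFin \o (fun t => d (i + k.+1)%N * phi i t)).
  by apply/integrable_I0Z/continuous_integrable_I0.
rewrite big_nat_recr //= -IHn addSnnS -(@primitiveZ _ L) //; last first.
  exact/continuous_integrable_I0.
rewrite -(@primitiveD _ L) //; last exact/continuous_integrable_I0/cpartial.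
by apply: eq_primitive => t _; rewrite big_nat_recr.
Qed.

(** Dominated convergence, with the constant bound of [partial_le], carries [primitive_partial] to
    the limit. *)
Lemma volterraE k x : 0 <= x <= L ->
  volterra k x = d k * g x + primitive (volterra k.+1) x.
Proof.
move=> xL; have xL' : x <= L by case/andP: xL.
have sub t : I0 x t -> 0 <= t <= L by move=> /(I0_subset xL'); rewrite /I0 /= in_itv.
pose B := 2 * (D * M ^+ k.+1 * expR (2 * M * L) * G).
have ic : mu.-integrable (I0 x) (EFin \o (fun=> B)).
  by apply: continuous_integrable_I0; exact: within_continuous_cst.
have ip n := integrable_I0S xL' (continuous_integrable_I0 (@cpartial k.+1 n)).
have [] := @dominated_convergence _ _ _ mu (I0 x) (measurable_I0 x)
  (fun n => EFin \o partial k.+1 n) (EFin \o volterra k.+1) (EFin \o (fun=> B)).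
- by move=> n; have /integrableP[] := ip n.
- by have /integrableP[] := integrable_I0S xL' (volterra_integrable k.+1).
- apply: aeW => t /sub tL; apply: cvg_EFin; first exact: nearW.
  exact: partial_cvg.
- exact: ic.
- by apply: aeW => t n /sub tL; rewrite lee_fin; exact: partial_le.
move=> _ _; rewrite -(@EFin_primitive _ L) //; last exact: volterra_integrable.
move=> /fine_cvg H.
have {}H : primitive (partial k.+1 n) x @[n --> \oo] --> primitive (volterra k.+1) x.
  exact: H.
have {}H : partial k n.+1 x @[n --> \oo] --> d k * g x + primitive (volterra k.+1) x.
  have : d k * g x + primitive (partial k.+1 n) x @[n --> \oo] -->
      d k * g x + primitive (volterra k.+1) x by apply: cvgD => //; exact: cvg_cst.
  apply: cvg_trans; apply: near_eq_cvg; apply: nearW => n.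
  by rewrite primitive_partial // addrC subrK.
have := @partial_cvg k x xL; rewrite -cvg_shiftS => H'.
exact: cvg_unique H' H.
Qed.

Lemma volterra_continuous k : {within I0 L, continuous (volterra k)}.
Proof.
apply: (@within_continuous_eq _ _ (fun x => d k * g x + primitive (volterra k.+1) x)).
  by move=> x; rewrite inE /I0 /= in_itv => xL; rewrite volterraE.
apply: within_continuousD.
  by apply: within_continuousM => //; exact: within_continuous_cst.
by apply: primitive_continuous; [exact: ltW|exact: volterra_integrable].
Qed.

(** In every partial sum the factor of [phi i] is the left-hand side of the recurrence at [i]. *)
Lemma volterra_eqn (lam : R) l x :
  (forall n, lam * d n + \sum_(1 <= j < l.+1) (-1) ^+ j.+1 * d (n + (2 * j).+1)%N = 0) ->
  0 <= x <= L ->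
  lam * volterra 0 x + \sum_(1 <= j < l.+1) (-1) ^+ j.+1 * volterra (2 * j).+1 x = 0.
Proof.
move=> deq xL.
have c1 : lam * partial 0 n x + \sum_(1 <= j < l.+1) (-1) ^+ j.+1 * partial (2 * j).+1 n x
  @[n --> \oo] -->
  lam * volterra 0 x + \sum_(1 <= j < l.+1) (-1) ^+ j.+1 * volterra (2 * j).+1 x.
  apply: cvgD; first by apply: cvgM; [exact: cvg_cst|exact: partial_cvg].
  apply: cvg_big => [|j _]; first exact: add_continuous.
  by apply: cvgM; [exact: cvg_cst|exact: partial_cvg].
apply: (cvg_unique _ c1) => //; apply: cvg_near_cst; apply: nearW => n.
rewrite /partial /series /= mulr_sumr; under [X in _ + X]eq_bigr do rewrite mulr_sumr.
rewrite exchange_big /= -big_split /= big1_seq // => i _.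
rewrite -[RHS](mul0r (phi i x)) -[X in _ = X * _](deq i).
rewrite mulrDl mulr_suml addn0 mulrA; congr (_ + _).
by apply: eq_bigr => j _; rewrite mulrA.
Qed.
End VolterraSeries.

(** * Existence *)

Section L2Estimates.
Context {R : realType}.
Notation mu := (@lebesgue_measure R).
Implicit Types (L x : R) (f g : R -> R).

Lemma primitive_cst (c x : R) : 0 <= x -> primitive (fun=> c) x = c * x.
Proof.
move=> x0; rewrite /primitive Rintegral_cst; last exact: measurable_I0.
by congr (_ * _); have /(congr1 fine) := mu_I0 x0.
Qed.

Lemma continuous_L2 L g : {within I0 L, continuous g} -> L2 L g.
Proof.
move=> cg; apply/L2P; split.
  by apply: subspace_continuous_measurable_fun; [exact: measurable_I0|].
by apply: continuous_integrable_I0; under eq_fun do rewrite expr2; exact: within_continuousM.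
Qed.

Lemma L2_integrable L f : L2 L f -> mu.-integrable (I0 L) (EFin \o f).
Proof.
move=> /L2P[mf if2].
have i1 : mu.-integrable (I0 L) (EFin \o (fun=> 1 : R)).
  by apply: continuous_integrable_I0; exact: within_continuous_cst.
apply: le_integrable (integrable_I0D if2 i1); first exact: measurable_I0.
  exact/measurable_EFinP.
move=> x _ /=; rewrite lee_fin [leRHS]ger0_norm ?addr_ge0 ?sqr_ge0 //.
rewrite -(real_normK (num_real (f x))); have := sqr_ge0 (`|f x| - 1).
by have := normr_ge0 (f x); nra.
Qed.

Lemma L2norm_sqr L f : L2norm L f ^+ 2 = primitive (fun x => f x ^+ 2) L.
Proof. by rewrite sqr_sqrtr //; apply: Rintegral_ge0 => x _; exact: sqr_ge0. Qed.

Lemma le_primitive L f g : mu.-integrable (I0 L) (EFin \o f) ->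
  mu.-integrable (I0 L) (EFin \o g) -> (forall x, 0 <= x <= L -> f x <= g x) ->
  primitive f L <= primitive g L.
Proof.
move=> intf intg fg; apply: le_Rintegral => //; exact: measurable_I0.
Qed.

Lemma L2norm_sqr_le L f g (A B : R) : 0 <= L -> L2 L f -> L2 L g ->
  (forall x, 0 <= x <= L -> g x ^+ 2 <= A * f x ^+ 2 + B) ->
  L2norm L g ^+ 2 <= A * L2norm L f ^+ 2 + B * L.
Proof.
move=> L0 /L2P[_ f2] /L2P[_ g2] gf; rewrite !L2norm_sqr.
have iB : mu.-integrable (I0 L) (EFin \o (fun=> B)).
  by apply: continuous_integrable_I0; exact: within_continuous_cst.
rewrite -(primitive_cst B L0) -(@primitiveZ _ L) // -(@primitiveD _ L) //; last first.
  exact: integrable_I0Z.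
by apply: le_primitive => //; apply: integrable_I0D => //; exact: integrable_I0Z.
Qed.

Lemma integrable_I0_norm L f : mu.-integrable (I0 L) (EFin \o f) ->
  mu.-integrable (I0 L) (EFin \o (fun x => `|f x|)).
Proof. exact: integrable_norm. Qed.

Lemma primitive_norm_le L f x : mu.-integrable (I0 L) (EFin \o f) -> 0 <= x <= L ->
  `|primitive f x| <= primitive (fun t => `|f t|) L.
Proof.
move=> intf /andP[x0 xL]; have intfx := integrable_I0S xL intf.
apply: le_trans (le_normr_Rintegral _ intfx) _; first exact: measurable_I0.
have intn := integrable_I0_norm intf.
rewrite -[leLHS]/(primitive (fun t => `|f t|) x) -lee_fin !(@EFin_primitive _ L) //.
apply: ge0_subset_integral => //; [exact: measurable_I0..| |exact: I0_subset].
by have /integrableP[] := intn.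
Qed.

(* Expanding [\int_0^L (|f| - m)^2 >= 0] with [m] the mean of [|f|]. *)
Lemma L1_sqr_le_L2 L f : 0 < L -> L2 L f ->
  primitive (fun t => `|f t|) L ^+ 2 <= L * L2norm L f ^+ 2.
Proof.
move=> L0 L2f; have /L2P[_ f2] := L2f.
have intn := integrable_I0_norm (L2_integrable L2f).
rewrite L2norm_sqr; set N := primitive (fun t => `|f t|) L; set A := primitive _ L; pose m := N / L.
have i1 : mu.-integrable (I0 L) (EFin \o (fun=> m ^+ 2)).
  by apply: continuous_integrable_I0; exact: within_continuous_cst.
have i2 : mu.-integrable (I0 L) (EFin \o (fun t => - 2 * m * `|f t|)).
  exact: integrable_I0Z.
have : 0 <= primitive (fun t => (f t ^+ 2 + - 2 * m * `|f t|) + m ^+ 2) L.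
  apply: Rintegral_ge0 => t _; rewrite -(real_normK (num_real (f t))).
  by rewrite (_ : _ + _ = (`|f t| - m) ^+ 2) ?sqr_ge0 //; ring.
rewrite (@primitiveD _ L) //; last exact: integrable_I0D.
rewrite (@primitiveD _ L) // primitive_cst ?(ltW L0) // (@primitiveZ _ L) // -/N -/A.
have -> : A + - 2 * m * N + m ^+ 2 * L = A - N ^+ 2 / L.
  by rewrite /m; field; rewrite gt_eqF.
by rewrite subr_ge0 ler_pdivrMr // mulrC.
Qed.

Lemma isH_sum (I : Type) (s : seq I) (c : I -> R) L m (p : nat -> R -> R)
    (h : I -> nat -> R -> R) : isH L m p -> (forall i, isH L m (h i)) ->
  isH L m (fun k x => p k x + \sum_(i <- s) c i * h i k x).
Proof.
move=> Hp Hh; elim: s => [|i s IHs].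
  rewrite (_ : (fun k x => _) = p) //; apply/funext => k; apply/funext => x.
  by rewrite big_nil addr0.
rewrite (_ : (fun k x => _) = (fun k x => (p k x + \sum_(j <- s) c j * h j k x) + c i * h i k x)).
  exact: isHD.
by apply/funext => k; apply/funext => x; rewrite big_cons addrCA addrC.
Qed.

Lemma isH0 L m : isH L m (fun _ _ => 0 : R).
Proof.
apply: isH_intro => [k _|||k _ x /andP[x0 _]]; first exact: within_continuous_cst.
- exact/continuous_L2/within_continuous_cst.
- exact/continuous_integrable_I0/within_continuous_cst.
- by rewrite primitive_cst // mul0r addr0.
Qed.
End L2Estimates.

(** * The [2l + 1] boundary conditions as linear functionals *)

Section BoundaryFunctionals.
Context {R : realType}.
Variables (L : R) (l : nat) (a b : nat -> R).
Implicit Types (u : nat -> R -> R).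

Definition bc_order r := if (r < 2)%N then 0%N else if r == 2%N then l else (l + r.-1./2)%N.
Definition bc_point r : R :=
  if r == 0%N then 0 else if (r < 3)%N then L else if odd r then 0 else L.
(** The value 0 for [r < 3] lets one formula cover the Dirichlet-type conditions and the coupled
    ones. *)
Definition bc_coef r : R :=
  if (r < 3)%N then 0 else if odd r then a r.-1./2 else b r.-1./2.

(* Indices [0, 1, 2] are the three Dirichlet-type conditions, [2j + 1] and
   [2j + 2] the conditions with coefficients [a j] and [b j]. *)
Definition bc_fun r u : R :=
  u (bc_order r) (bc_point r) - bc_coef r * u (l - r.-1./2)%N (bc_point r).

Lemma bc_funP u : (0 < l)%N ->
  (forall r, (r < (2 * l).+1)%N -> bc_fun r u = 0) -> BC L l a b u.
Proof.
move=> l0 H; split.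
- by have /(_ isT) := H 0%N; rewrite /bc_fun /= mul0r subr0.
- by have := H 1%N; rewrite /bc_fun /= mul0r subr0; apply; lia.
- by have := H 2%N; rewrite /bc_fun /= mul0r subr0; apply; lia.
move=> j /andP[j1 jl]; split.
  have /(_ _)/eqP := H (2 * j + 1)%N; rewrite /bc_fun /bc_order /bc_point /bc_coef.
  rewrite (_ : (2 * j + 1 < 2)%N = false) 1?(_ : (2 * j + 1 < 3)%N = false); [|lia..].
  rewrite (_ : (2 * j + 1 == 2)%N = false) 1?(_ : (2 * j + 1 == 0)%N = false); [|lia..].
  rewrite oddD oddM /= addn1 /= mul2n doubleK subr_eq0 => H1.
  by apply/eqP/H1; lia.
have /(_ _)/eqP := H (2 * j + 2)%N; rewrite /bc_fun /bc_order /bc_point /bc_coef.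
rewrite (_ : (2 * j + 2 < 2)%N = false) 1?(_ : (2 * j + 2 < 3)%N = false); [|lia..].
rewrite (_ : (2 * j + 2 == 2)%N = false) 1?(_ : (2 * j + 2 == 0)%N = false); [|lia..].
rewrite oddD oddM /= addn2 /= mul2n uphalf_double subr_eq0 => H1.
by apply/eqP/H1; lia.
Qed.

Lemma bc_fun_sum (I : Type) (s : seq I) (c : I -> R) r p (h : I -> nat -> R -> R) :
  bc_fun r (fun k x => p k x + \sum_(i <- s) c i * h i k x) =
  bc_fun r p + \sum_(i <- s) c i * bc_fun r (h i).
Proof.
rewrite /bc_fun; elim: s => [|i s IHs]; first by rewrite !big_nil !addr0.
by rewrite !big_cons; move: IHs; lra.
Qed.

(** Only orders up to [2 * l] occur, and these admit pointwise bounds, unlike the top derivative. *)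
Lemma bc_fun_le r u (K : R) : 0 <= L -> (r < (2 * l).+1)%N ->
  (forall k x, (k <= 2 * l)%N -> 0 <= x <= L -> `|u k x| <= K) ->
  `|bc_fun r u| <= (1 + `|bc_coef r|) * K.
Proof.
move=> L0 rl uK.
have pt : 0 <= bc_point r <= L.
  by rewrite /bc_point; do 3?case: ifP => _; rewrite ?lexx ?L0.
apply: le_trans (ler_normB _ _) _; rewrite mulrDl mul1r lerD //.
  apply: uK => //; rewrite /bc_order; case: ifP => // _; case: ifP => // _; first by lia.
  by have := odd_double_half r.-1; lia.
by rewrite normrM ler_wpM2l //; apply: uK => //; lia.
Qed.
End BoundaryFunctionals.

(** * The recurrence attached to the equation *)

Section FundamentalSequences.
Context {R : realFieldType}.
Variables (lam : R) (l : nat).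

(** The homogeneous equation solved for the derivative of order [2l + 1]: dividing by [(-1) ^+ l.+1]
    and changing sides leaves the sign [(-1) ^+ l]. *)
Definition eq_coef (k : nat) : R := (-1) ^+ l *
  (lam * (k == 0%N)%:R + \sum_(1 <= j < l) (-1) ^+ j.+1 * (k == (2 * j).+1)%:R).

Definition basis_seq (i : nat) : nat -> R :=
  rec_seq (2 * l).+1 eq_coef (fun k => (k == i)%:R).

Lemma basis_seq_init i k : (k <= 2 * l)%N -> basis_seq i k = (k == i)%:R.
Proof. by move=> kl; rewrite /basis_seq rec_seq_init. Qed.

Lemma sum_delta n i (F : nat -> R) : (i < n)%N ->
  \sum_(k < n) (val k == i)%:R * F k = F i.
Proof.
move=> ni; rewrite (bigD1 (Ordinal ni)) //= eqxx mul1r big1 ?addr0 // => k ki.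
by rewrite (negbTE (_ : val k != i)) ?mul0r.
Qed.

Lemma basis_seq_eqn i n : (0 < l)%N -> lam * basis_seq i n +
  \sum_(1 <= j < l.+1) (-1) ^+ j.+1 * basis_seq i (n + (2 * j).+1)%N = 0.
Proof.
move=> l0; set d := basis_seq i; rewrite big_nat_recr //= addrA.
have -> : d (n + (2 * l).+1)%N = (-1) ^+ l *
    (lam * d n + \sum_(1 <= j < l) (-1) ^+ j.+1 * d (n + (2 * j).+1)%N).
  rewrite {1}/d /basis_seq rec_seqE // /eq_coef.
  under eq_bigr do rewrite -mulrA; rewrite -mulr_sumr; congr (_ * _).
  under eq_bigr do rewrite mulrDl mulr_suml -mulrA.
  rewrite big_split /= -mulr_sumr (sum_delta (fun k => d (n + k)%N)) // addn0.
  congr (_ + _); rewrite exchange_big /=; apply: eq_big_nat => j /andP[j1 jl].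
  under eq_bigr do rewrite -mulrA; rewrite -mulr_sumr (sum_delta (fun k => d (n + k)%N)) //.
  by lia.
set S := _ + \sum_(_ <= _ < _) _.
rewrite [X in S + X](_ : _ = - ((-1) ^+ l * (-1) ^+ l) * S); last by rewrite exprS; ring.
by rewrite -exprMn mulrNN mulr1 expr1n mulN1r subrr.
Qed.
End FundamentalSequences.

(** * Basis solutions, a particular solution and the linear system *)

Section Existence.
Context {R : realType}.
Notation mu := (@lebesgue_measure R).
Variables (L lam : R) (l : nat).
Hypotheses (L0 : 0 < L) (lam0 : 0 < lam) (l2 : (2 <= l)%N).

Let d := basis_seq lam l.
Let l0 : (0 < l)%N. Proof. exact: leq_trans l2. Qed.

Definition basis_sol i : nat -> R -> R := volterra (fun=> 1) (d i).

Let basis_sol_facts i : exists K,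
  [/\ isH L (2 * l).+1 (basis_sol i),
      forall k x, (k <= (2 * l).+1)%N -> 0 <= x <= L -> `|basis_sol i k x| <= K,
      forall k, (k <= 2 * l)%N -> basis_sol i k 0 = (k == i)%:R &
      forall x, 0 <= x <= L -> lam * basis_sol i 0%N x +
        \sum_(1 <= j < l.+1) (-1) ^+ j.+1 * basis_sol i (2 * j).+1 x = 0].
Proof.
have [D [M [D0 M1 dD]]] := rec_seq_bound (2 * l).+1 (eq_coef lam l) (fun k => (k == i)%:R).
have c1 : {within I0 L, continuous (fun=> 1 : R)} by exact: within_continuous_cst.
have g1 x : 0 <= x <= L -> `|1 : R| <= 1 by rewrite normr1.
have cU k := @volterra_continuous _ _ _ _ _ _ _ L0 D0 M1 c1 g1 dD k.
have UE k x := @volterraE _ _ _ _ _ _ _ L0 D0 M1 c1 g1 dD k x.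
(* At 0 only the first term of the series survives, so [d i] lists the derivatives at 0. *)
have U0 k : basis_sol i k 0 = d i k.
  by rewrite /basis_sol UE ?lexx ?ltW // primitive0 addr0 mulr1.
exists (2 * (D * M ^+ (2 * l).+1 * expR (2 * M * L) * 1)); split.
- apply: isH_intro => [k _|||k _ x xL]; first exact: cU.
  + exact/continuous_L2/cU.
  + exact/continuous_integrable_I0/cU.
  + by rewrite U0 [LHS]UE // mulr1.
- move=> k x kl xL.
  apply: le_trans (volterra_le L0 D0 M1 c1 g1 dD k xL) _.
  rewrite ler_wpM2l // ler_wpM2r // ler_wpM2r ?expR_ge0 // ler_wpM2l //.
  exact: ler_weXn2l.
- by move=> k kl; rewrite U0 /d basis_seq_init.
- move=> x xL; apply: (volterra_eqn L0 D0 M1 c1 g1 dD) => // n.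
  exact: basis_seq_eqn.
Qed.

(** The sequence [d (2 * l)] is 0 before its entry 1 at [2 * l], so [primitive f] first appears at
    order [2 * l] and contributes [f] to the next derivative; hence the extra term. The sign cancels
    the leading coefficient [(-1) ^+ l.+1]. *)
Definition particular_sol (f : R -> R) : nat -> R -> R := fun k x =>
  (-1) ^+ l.+1 * (volterra (primitive f) (d (2 * l)) k x +
                  (k == (2 * l).+1)%:R * f x).

(** [K] is fixed before [f]. The bound without [|f x|] serves the boundary functionals; the other
    one includes the top order. *)
Let particular_sol_facts : exists2 K, 0 <= K & forall f, L2 L f ->
  [/\ isH L (2 * l).+1 (particular_sol f),
      forall k x, (k <= 2 * l)%N -> 0 <= x <= L ->
        `|particular_sol f k x| <= K * primitive (fun t => `|f t|) L,
      forall k x, (k <= (2 * l).+1)%N -> 0 <= x <= L ->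
        `|particular_sol f k x| <= K * primitive (fun t => `|f t|) L + `|f x| &
      forall x, 0 <= x <= L -> lam * particular_sol f 0%N x +
        \sum_(1 <= j < l.+1) (-1) ^+ j.+1 * particular_sol f (2 * j).+1 x = f x].
Proof.
have [D [M [D0 M1 dD]]] := rec_seq_bound (2 * l).+1 (eq_coef lam l) (fun k => (k == 2 * l)%N%:R).
have M0 : 0 <= M by exact: le_trans M1.
exists (2 * (D * M ^+ (2 * l).+1 * expR (2 * M * L))).
  by do ?[apply: mulr_ge0|exact: expR_ge0|exact: exprn_ge0].
move=> f L2f; have intf := L2_integrable L2f.
set N := primitive (fun t => `|f t|) L.
have cF : {within I0 L, continuous (primitive f)}.
  by apply: primitive_continuous => //; exact: ltW.
have FN x : 0 <= x <= L -> `|primitive f x| <= N by move=> xL; exact: primitive_norm_le.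
have cU k := @volterra_continuous _ _ _ _ _ _ _ L0 D0 M1 cF FN dD k.
have UE k x : 0 <= x <= L -> volterra (primitive f) (d (2 * l)) k x =
    d (2 * l) k * primitive f x + primitive (volterra (primitive f) (d (2 * l)) k.+1) x.
  exact: (volterraE L0 D0 M1 cF FN dD).
set s : R := (-1) ^+ l.+1.
have s1 : `|s| = 1 by rewrite /s normrX normrN1 expr1n.
have U0 k : volterra (primitive f) (d (2 * l)) k 0 = 0.
  by rewrite UE ?lexx ?ltW // !primitive0 addr0 mulr0.
have N0 : 0 <= N by apply: Rintegral_ge0 => t _.
have UN k x : (k <= (2 * l).+1)%N -> 0 <= x <= L ->
    `|volterra (primitive f) (d (2 * l)) k x| <= 2 * (D * M ^+ (2 * l).+1 * expR (2 * M * L)) * N.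
  move=> kl xL; apply: le_trans (volterra_le L0 D0 M1 cF FN dD k xL) _.
  rewrite -[leRHS]mulrA ler_wpM2l // ler_wpM2r // ler_wpM2r ?expR_ge0 // ler_wpM2l //.
  exact: ler_weXn2l.
have pk k : (k <= 2 * l)%N -> particular_sol f k =
    (fun x => s * volterra (primitive f) (d (2 * l)) k x).
  by move=> kl; apply/funext => x; rewrite /particular_sol ltn_eqF // mul0r addr0.
have pm : particular_sol f (2 * l).+1 =
    (fun x => s * (volterra (primitive f) (d (2 * l)) (2 * l).+1 x + f x)).
  by apply/funext => x; rewrite /particular_sol eqxx mul1r.
have cp k : (k < (2 * l).+1)%N -> {within I0 L, continuous (particular_sol f k)}.
  move=> kl; rewrite pk //.
  by apply: within_continuousM; [exact: within_continuous_cst|exact: cU].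
have iU := continuous_integrable_I0 (cU (2 * l).+1).
split.
- apply: isH_intro => //.
  + rewrite pm (_ : (fun x => _) = (fun x =>
      s * volterra (primitive f) (d (2 * l)) (2 * l).+1 x + s * f x)); last first.
      by apply/funext => x; rewrite mulrDr.
    apply: L2D => //; apply/continuous_L2/within_continuousM; last exact: cU.
    exact: within_continuous_cst.
  + by rewrite pm; apply/integrable_I0Z/integrable_I0D.
  + move=> k kl x xL; have xL' : x <= L by case/andP: xL.
    rewrite pk // U0 mulr0 add0r UE //.
    move: kl; rewrite ltnS leq_eqVlt => /predU1P[->|kl].
      rewrite pm (@primitiveZ _ L) //; last exact: integrable_I0D.
      rewrite (@primitiveD _ L) // [d _ _]basis_seq_init // eqxx mul1r.
      by rewrite [primitive f x + _]addrC.
    rewrite pk // (@primitiveZ _ L) //; last exact/continuous_integrable_I0/cU.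
    by rewrite [d _ _]basis_seq_init ?(ltnW kl) // ltn_eqF // mul0r add0r.
- by move=> k x kl xL; rewrite pk // normrM s1 mul1r UN // ltnW.
- move=> k x kl xL; rewrite /particular_sol normrM s1 mul1r.
  apply: le_trans (ler_normD _ _) _; rewrite lerD ?UN // normrM.
  by case: eqP => _; rewrite ?normr1 ?mul1r // normr0 mul0r.
- move=> x xL.
  have E := volterra_eqn L0 D0 M1 cF FN dD (fun n => basis_seq_eqn lam (2 * l) n l0) xL.
  rewrite big_nat_recr //= pm pk //.
  move: E; rewrite big_nat_recr //= -/s.
  set V := volterra _ _; have ss : s * s = 1 by rewrite /s -exprMn mulrNN mulr1 expr1n.
  rewrite (eq_big_nat _ _ (F1 := fun j => _ * particular_sol f _ x)
    (F2 := fun j => s * ((-1) ^+ j.+1 * V (2 * j).+1 x))); last first.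
    move=> j /andP[_ jl].
    have jl2 : ((2 * j).+1 <= 2 * l)%N by rewrite ltn_mul2l jl.
    by rewrite (pk _ jl2); exact: mulrCA.
  rewrite -mulr_sumr; set S := \sum_(_ <= _ < _) _ => E.
  have -> : lam * (s * V 0%N x) + (s * S + s * (s * (V (2 * l).+1 x + f x))) =
    s * (lam * V 0%N x + (S + s * V (2 * l).+1 x)) + s * s * f x by ring.
  by rewrite E mulr0 add0r ss mul1r.
Qed.

Variables (a b : nat -> R).
Hypothesis ab : coef_cond l a b.

Let n := (2 * l).+1.

(** Rows are indexed by basis solutions, so row vectors of coefficients multiply from the left. *)
Definition bc_matrix : 'M[R]_n := \matrix_(i, r) bc_fun L l a b r (basis_sol i).

Let Eqn_pointwise f u : (forall x, 0 <= x <= L -> lam * u 0%N x +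
    \sum_(1 <= j < l.+1) (-1) ^+ j.+1 * u (2 * j).+1 x = f x) -> Eqn L lam l f u.
Proof. by move=> E; apply: aeW => x /andP[x0 xL]; rewrite E // !ltW. Qed.

Let Eqn_sum (c : 'I_n -> R) p (g : R -> R) x : 0 <= x <= L ->
  lam * p 0%N x + \sum_(1 <= j < l.+1) (-1) ^+ j.+1 * p (2 * j).+1 x = g x ->
  lam * (p 0%N x + \sum_i c i * basis_sol i 0%N x) +
    \sum_(1 <= j < l.+1) (-1) ^+ j.+1 *
      (p (2 * j).+1 x + \sum_i c i * basis_sol i (2 * j).+1 x) = g x.
Proof.
move=> xL Ep.
under [X in _ + X]eq_bigr do rewrite mulrDr.
rewrite big_split /= mulrDr addrACA Ep.
under [X in _ + (_ + X)]eq_bigr do rewrite mulr_sumr.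
rewrite exchange_big /= mulr_sumr -big_split /= big1 ?addr0 // => i _.
have [K [_ _ _ /(_ x xL) E]] := basis_sol_facts i.
rewrite -[RHS](mulr0 (c i)) -[X in _ = _ * X]E mulrDr mulr_sumr mulrCA; congr (_ + _).
by apply: eq_bigr => j _; rewrite mulrCA.
Qed.

(** A row vector in the left kernel yields a solution of the homogeneous problem. Its derivatives at
    0 are the entries of the vector, and they vanish by uniqueness. *)
Lemma bc_matrix_unit : bc_matrix \in unitmx.
Proof.
rewrite unitmxE unitfE; apply/negP => /det0P[v v0 vT].
pose w k x : R := 0 + \sum_i v 0 i * basis_sol i k x.
have Sw : solution L lam l a b (fun=> 0) w.
  split.
  - apply: isH_sum; first exact: isH0.
    by move=> i; have [K []] := basis_sol_facts i.
  - apply: bc_funP => // r rn; rewrite bc_fun_sum /bc_fun mulr0 subr0 add0r.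
    have /rowP/(_ (Ordinal rn)) := vT; rewrite !mxE => E; rewrite -[RHS]E.
    by apply: eq_bigr => i _; rewrite !mxE.
  - apply: Eqn_pointwise => x xL.
    apply: (@Eqn_sum _ (fun _ _ => 0) (fun=> 0)) => //.
    by rewrite mulr0 add0r big1 // => j _; rewrite mulr0.
have [_ wz] := homogeneous_solution_eq0 L0 lam0 l2 ab Sw.
case/negP: v0; apply/eqP/rowP => k; rewrite mxE.
rewrite -[RHS](wz k (ltn_ord k)) /w add0r (bigD1 k) //= big1 => [|i ik].
  have [K [_ _ + _]] := basis_sol_facts k => ->; last exact: (ltn_ord k).
  by rewrite eqxx mulr1 addr0.
have [K [_ _ + _]] := basis_sol_facts i => ->; last exact: (ltn_ord k).
by rewrite eq_sym (negbTE (_ : val i != k)) ?mulr0.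
Qed.

Lemma solution_exists : exists C : R, 0 < C /\ forall f, L2 L f ->
  exists u, solution L lam l a b f u /\ Hnorm L (2 * l).+1 u <= C * L2norm L f.
Proof.
have [K hK] := choice basis_sol_facts.
have [Kp Kp0 hp] := particular_sol_facts.
(* [Kc i * N] will bound the coefficient of the basis solution [i], with [N] the integral of
   [|f|]. *)
pose Kc (i : 'I_n) := \sum_(r < n) (1 + `|bc_coef a b r|) * Kp * `|invmx bc_matrix r i|.
pose C1 := Kp + \sum_(i < n) Kc i * K i.
(* From [|u k x| <= C1 * N + |f x|]: squaring gives the factors 2, integration a factor [L], and
   [N ^+ 2 <= L * L2norm L f ^+ 2] another one. *)
pose C2 := 2 + 2 * C1 ^+ 2 * L ^+ 2.
have C2_gt0 : 0 < C2.
  by apply: ltr_pwDl => //; do ?[exact: sqr_ge0|apply: mulr_ge0].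
(* [Hnorm] sums [2l + 2] squared norms, each at most [C2 * L2norm L f ^+ 2]. *)
exists (Num.sqrt ((2 * l).+2%:R * C2)); split; first by rewrite sqrtr_gt0 mulr_gt0.
move=> f L2f; have [Hp p_le p_le' pE] := hp f L2f.
set p := particular_sol f in Hp p_le p_le' pE.
set N := primitive _ L in p_le p_le'.
have N0 : 0 <= N by apply: Rintegral_ge0 => t _.
(* The coefficients that cancel the boundary defects of the particular solution. *)
pose c := - (\row_r bc_fun L l a b (val r) p) *m invmx bc_matrix.
have c_le i : `|c 0 i| <= Kc i * N.
  rewrite /c mxE /Kc mulr_suml; apply: le_trans (ler_norm_sum _ _ _) _.
  apply: ler_sum => r _; rewrite !mxE normrM normrN mulrAC ler_wpM2r //.
  rewrite -mulrA; apply: bc_fun_le => //; [exact: ltW|exact: ltn_ord].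
pose u k x := p k x + \sum_i c 0 i * basis_sol i k x.
have Hu : isH L (2 * l).+1 u.
  by apply: isH_sum => // i; have [] := hK i.
have u_le k x : (k <= (2 * l).+1)%N -> 0 <= x <= L -> `|u k x| <= C1 * N + `|f x|.
  move=> kl xL; apply: le_trans (ler_normD _ _) _.
  rewrite mulrDl addrAC lerD ?p_le' //.
  apply: le_trans (ler_norm_sum _ _ _) _; rewrite mulr_suml; apply: ler_sum => i _.
  rewrite normrM mulrAC ler_pM //.
  by have [_ + _ _] := hK i; apply.
exists u; split.
  split=> //.
    apply: bc_funP => // r rn; rewrite bc_fun_sum.
    have : c *m bc_matrix = - \row_r bc_fun L l a b (val r) p.
      by rewrite /c -mulmxA mulVmx ?mulmx1 // bc_matrix_unit.
    move=> /rowP/(_ (Ordinal rn)); rewrite !mxE /= => E.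
    rewrite [X in _ + X](_ : _ = - bc_fun L l a b r p) ?subrr // -E.
    by apply: eq_bigr => i _; rewrite !mxE.
  by apply: Eqn_pointwise => x xL; apply: Eqn_sum => //; exact: pE.
have N2 := L1_sqr_le_L2 L0 L2f; rewrite -/N in N2.
have Lu k : (k < (2 * l).+2)%N -> L2norm L (u k) ^+ 2 <= C2 * L2norm L f ^+ 2.
  move=> kl; have L2u : L2 L (u k).
    have [cu L2u _ _] := Hu; move: kl; rewrite ltnS leq_eqVlt => /predU1P[-> //|kl].
    exact/continuous_L2/cu.
  apply: le_trans (@L2norm_sqr_le _ L f (u k) 2 (2 * C1 ^+ 2 * N ^+ 2) _ L2f L2u _) _.
  - exact: ltW.
  - move=> x xL; have := u_le k x kl xL.
    rewrite -(real_normK (num_real (u k x))) -(real_normK (num_real (f x))) => H.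
    have := sqr_ge0 (C1 * N - `|f x|).
    have : `|u k x| ^+ 2 <= (C1 * N + `|f x|) ^+ 2.
      by rewrite lerXn2r // nnegrE // (le_trans _ H).
    nra.
  - have C10 : 0 <= 2 * C1 ^+ 2 * L by do ?[exact: sqr_ge0|exact: ltW|apply: mulr_ge0].
    by have := ler_wpM2l C10 N2; rewrite /C2; lra.
rewrite -[leRHS]ger0_norm ?mulr_ge0 ?sqrtr_ge0 // -sqrtr_sqr ler_sqrt ?sqr_ge0 //.
rewrite exprMn sqr_sqrtr ?mulr_ge0 ?(ltW C2_gt0) //.
rewrite -mulrA mulr_natl -[X in _ *+ X]subn0 -sumr_const_nat.
by apply: ler_sum_nat => k /andP[_ kl]; exact: Lu.
Qed.
End Existence.

Theorem theorem1 (R : realType) (L lam : R) (l : nat) (a b : nat -> R) :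
  0 < L -> 0 < lam -> (2 <= l)%N -> coef_cond l a b ->
  exists C : R, 0 < C /\
    forall f : R -> R, L2 L f ->
      (exists u : nat -> R -> R,
         solution L lam l a b f u /\
         Hnorm L (2 * l).+1 u <= C * L2norm L f) /\
      (forall u v : nat -> R -> R,
         solution L lam l a b f u -> solution L lam l a b f v ->
         forall x, 0 <= x <= L -> u 0%N x = v 0%N x).
Proof.
move=> L0 lam0 l2 ab; have [C [C0 H]] := solution_exists L0 lam0 l2 ab.
exists C; split=> // f L2f; split; first exact: H.
by move=> u v Su Sv; exact: solution_unique Su Sv.
Qed.
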